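(* Let $f\colon\mathbb{R}^n\to\overline{\mathbb{R}}$ be a lower-semicontinuous, semi-algebraic function and let $\bar{x}\in\mathbb{R}^n$ be a local minimizer of $f$. Consider the following two statements. (1) The limiting subdifferential $\partial f\colon\mathbb{R}^n\rightrightarrows\mathbb{R}^n$ is strongly metrically subregular at $(\bar{x},0)$ with modulus $\kappa$. (2) There exist real numbers $\alpha>0$ and $\varepsilon>0$ such that $$f(x)\geq f(\bar{x})+\frac{\alpha}{2}\|x-\bar{x}\|^2\quad\text{for all } x\in\mathbb{B}_{\varepsilon}(\bar{x}).$$ Then the implication (1) $\Rightarrow$ (2) holds, and $\alpha$ can be chosen arbitrarily in $(0,\kappa^{-1})$: if (1) holds with modulus $\kappa$, then for every $\alpha\in(0,\kappa^{-1})$ there is $\varepsilon>0$ such that the inequality in (2) holds. Conversely, if $f$ is subdifferentially continuous at $\bar{x}$ for $\bar{v}=0$, then (2) implies (1), that is, (2) implies that $\partial f$ is strongly metrically subregular at $(\bar{x},0)$ with some modulus $\kappa$.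
   Context: $\|\cdot\|$ is the Euclidean norm on $\mathbb{R}^n$, $\mathbb{B}_\varepsilon(\bar{x})$ is the closed ball of radius $\varepsilon$ centered at $\bar{x}$, and $\overline{\mathbb{R}}=\mathbb{R}\cup\{-\infty\}\cup\{+\infty\}$. For a set $Q$, $d(x;Q)=\inf_{y\in Q}\|x-y\|$, with $d(x;\emptyset)=+\infty$. The epigraph of $f\colon\mathbb{R}^n\to\overline{\mathbb{R}}$ is $\mathrm{epi}\, f=\{(x,r)\in\mathbb{R}^n\times\mathbb{R}: r\geq f(x)\}$. A semi-algebraic set is a finite union of sets, each defined by finitely many polynomial equalities and strict polynomial inequalities; $f$ is semi-algebraic if $\mathrm{epi}\, f\subset\mathbb{R}^{n+1}$ is a semi-algebraic set. Normal cones: for $Q\subset\mathbb{R}^m$ and $\bar{z}\in Q$, the Fréchet normal cone $\hat N_Q(\bar z)$ consists of all $v$ with $\langle v,z-\bar z\rangle\leq o(\|z-\bar z\|)$ for $z\in Q$ (i.e. the error term divided by $\|z-\bar z\|$ tends to $0$ as $z\to\bar z$, $z\in Q$, $z\neq\bar z$). The limiting normal cone $N_Q(\bar z)$ consists of all $v$ for which there are sequences $z_i\to\bar z$ with $z_i\in Q$, and $v_i\to v$ with $v_i\in\hat N_Q(z_i)$. Limiting subdifferential: if $f(x)$ is finite, $\partial f(x)=\{v\in\mathbb{R}^n:(v,-1)\in N_{\mathrm{epi}\, f}(x,f(x))\}$; if $f(x)$ is not finite, $\partial f(x)=\emptyset$. Strong metric subregularity: a set-valued mapping $F\colon\mathbb{R}^n\rightrightarrows\mathbb{R}^m$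 is strongly metrically subregular at $(\bar x,\bar y)$, where $\bar y\in F(\bar x)$, with modulus $\kappa\geq 0$ if there is $\varepsilon>0$ such that $\|x-\bar x\|\leq\kappa\, d(\bar y;F(x))$ for all $x\in\mathbb{B}_\varepsilon(\bar x)$. Subdifferential continuity: $f$ is subdifferentially continuous at $\bar x$ for $\bar v\in\partial f(\bar x)$ if for any sequences $x_i\to\bar x$ and $v_i\to\bar v$ with $v_i\in\partial f(x_i)$, one has $f(x_i)\to f(\bar x)$. *)

(* Defs.v *)
From mathcomp Require Import all_boot all_order all_algebra.
From mathcomp Require Import mpoly.
From mathcomp Require Import boolp classical_sets functions reals ereal.
From mathcomp Require Import topology normedtype sequences.

Set Implicit Arguments.
Unset Strict Implicit.
Unset Printing Implicit Defensive.

Import Order.TTheory GRing.Theory Num.Theory.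
Import numFieldNormedType.Exports.

Local Open Scope classical_set_scope.
Local Open Scope ring_scope.

(* The canonical norm of 'rV[R]_n in MathComp-Analysis is the sup norm. It has
   the same topology as the Euclidean norm, so limits and neighbourhoods are
   the library's, but every quantity below that depends on the norm itself uses
   [enorm]. *)

Definition edot (R : realType) (n : nat) (x y : 'rV[R]_n) : R :=
  \sum_(i < n) x 0 i * y 0 i.

Definition enorm (R : realType) (n : nat) (x : 'rV[R]_n) : R :=
  Num.sqrt (edot x x).

Definition eball (R : realType) (n : nat) (xbar : 'rV[R]_n) (eps : R) :
  set 'rV[R]_n := [set x | enorm (x - xbar) <= eps].

(* [ereal_inf set0 = +oo] *)
Definition edistance (R : realType) (n : nat) (x : 'rV[R]_n)
  (Q : set 'rV[R]_n) : \bar R := ereal_inf [set (enorm (x - y))%:E | y in Q].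

(* The pair (x, r) in R^n * R is encoded as the row vector
   [row_mx x r%:M : 'rV[R]_(n + 1)]. *)
Definition epi (R : realType) (n : nat) (f : 'rV[R]_n -> \bar R) :
  set 'rV[R]_(n + 1) :=
  [set z | (f (lsubmx z) <= (rsubmx z 0 0)%:E)%E].

(* A pair of lists (ps, qs) stands for the system p = 0, q > 0. *)
Definition basic_semialgebraic (R : realType) (m : nat)
  (c : seq {mpoly R[m]} * seq {mpoly R[m]}) : set 'rV[R]_m :=
  [set x | all (fun p => p.@[x 0] == 0) c.1 && all (fun q => 0 < q.@[x 0]) c.2].

Definition semialgebraic_set (R : realType) (m : nat) (A : set 'rV[R]_m) :
  Prop :=
  exists cs : seq (seq {mpoly R[m]} * seq {mpoly R[m]}),
    A = \bigcup_(c in [set` cs]) basic_semialgebraic c.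

Definition semialgebraic (R : realType) (n : nat) (f : 'rV[R]_n -> \bar R) :
  Prop := semialgebraic_set (epi f).

(* The normal cones are only meaningful at points of Q. *)

Definition frechet_normal_cone (R : realType) (m : nat) (Q : set 'rV[R]_m)
  (zbar : 'rV[R]_m) : set 'rV[R]_m :=
  [set v | exists o : 'rV[R]_m -> R,
    (o z / enorm (z - zbar) @[z --> within Q zbar^'] --> (0 : R)) /\
    forall z, Q z -> edot v (z - zbar) <= o z].

Definition limiting_normal_cone (R : realType) (m : nat) (Q : set 'rV[R]_m)
  (zbar : 'rV[R]_m) : set 'rV[R]_m :=
  [set v | exists z_ v_ : nat -> 'rV[R]_m,
    [/\ z_ @ \oo --> zbar, forall i, Q (z_ i), v_ @ \oo --> v &
        forall i, frechet_normal_cone Q (z_ i) (v_ i)]].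

Definition subdifferential (R : realType) (n : nat) (f : 'rV[R]_n -> \bar R)
  (x : 'rV[R]_n) : set 'rV[R]_n :=
  [set v | f x \is a fin_num /\
    limiting_normal_cone (epi f) (row_mx x (fine (f x))%:M)
      (row_mx v (-1)%:M)].

(* When [F x] is empty the distance is +oo and the inequality is to hold
   trivially, also for kappa = 0; as the library sets 0 * +oo = 0, that case is
   excluded explicitly. *)
Definition strongly_subregular (R : realType) (n m : nat)
  (F : 'rV[R]_n -> set 'rV[R]_m) (xbar : 'rV[R]_n) (ybar : 'rV[R]_m)
  (kappa : R) : Prop :=
  [/\ F xbar ybar, 0 <= kappa &
    exists2 eps : R, 0 < eps &
      forall x, eball xbar eps x -> F x !=set0 ->
        ((enorm (x - xbar))%:E <= kappa%:E * edistance ybar (F x))%E].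

Definition subdifferentially_continuous (R : realType) (n : nat)
  (f : 'rV[R]_n -> \bar R) (xbar vbar : 'rV[R]_n) : Prop :=
  subdifferential f xbar vbar /\
  forall x_ v_ : nat -> 'rV[R]_n,
    x_ @ \oo --> xbar -> v_ @ \oo --> vbar ->
    (forall i, subdifferential f (x_ i) (v_ i)) ->
    f (x_ i) @[i --> \oo] --> f xbar.

Definition local_minimizer (R : realType) (n : nat) (f : 'rV[R]_n -> \bar R)
  (xbar : 'rV[R]_n) : Prop := \forall x \near xbar, (f xbar <= f x)%E.

Definition quadratic_growth (R : realType) (n : nat) (f : 'rV[R]_n -> \bar R)
  (xbar : 'rV[R]_n) (alpha : R) : Prop :=
  exists2 eps : R, 0 < eps &
    forall x, eball xbar eps x ->
      (f xbar + (alpha / 2 * enorm (x - xbar) ^+ 2)%:E <= f x)%E.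

(* Main.v *)
Require Import Defs.
From mathcomp Require Import all_boot all_order all_algebra.
From mathcomp Require Import mpoly.
From mathcomp Require Import polyrcf ordered_qelim qe_rcf.
From mathcomp Require Import boolp classical_sets cardinality.
From mathcomp Require Import reals ereal.
From mathcomp Require Import topology normedtype.
From mathcomp Require Import realfun lebesgue_measure.
From mathcomp Require Import ring lra.

Set Implicit Arguments.
Unset Strict Implicit.
Unset Printing Implicit Defensive.

Import Order.TTheory GRing.Theory Num.Theory.
Import numFieldNormedType.Exports.

Local Open Scope classical_set_scope.
Local Open Scope ring_scope.

(** (1) => (2). If the growth inequality fails at [x0] close to [xbar], minimise
    [f + (alpha / 2) * | |x - xbar|^2 - |x0 - xbar|^2 |] (with the absolute
    value smoothed) over the ball [|x - xbar|^2 <= 2 |x0 - xbar|^2]. The minimum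
    is attained at an interior point [y <> xbar], where [f] has a subgradient of
    norm at most [alpha |y - xbar|], against subregularity as [kappa * alpha <
    1]. Semi-algebraicity plays no role here.

    (2) => (1). Translate the epigraph so that [(xbar, f xbar)] becomes the
    origin. If (1) fails, there are arbitrarily small [t > 0] and points [z] of
    the epigraph of l1-norm [t] at which the height decreases along the epigraph
    at rate at most [k * t], where [k] is as small as we please: limiting
    normals are approximated by Frechet normals, and subdifferential continuity
    makes the height tend to [0]. By quantifier elimination these points can be
    selected as a definable curve [z t], defined for all small [t]. Definable
    functions of one variable are monotone near [0], so all [|z_i t|] are
    nondecreasing; since they sum up to [t], the curve satisfies [|z t - z s|_1
    = t - s] locally. Hence the height minus [k * t^2] is locally, then
    globally, nonincreasing, and the height is at most [k * t^2], which
    contradicts quadratic growth. *)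

(** * Definability over the reals *)

Section Definability.
Variable R : realType.

(* A context presents the points of [E] as lists of reals of a fixed length, so
   that polynomial functions and first-order predicates on [E] can be reified.
   Evaluation is required to ignore any suffix of the list: this makes
   weakening to a larger context free. *)
Record context (E : Type) := Context {
  coords : E -> seq R;
  ncoords : nat;
  size_coords : forall e, size (coords e) = ncoords }.

Definition polyfun E (c : context E) (u : E -> R) :=
  exists2 t : GRing.term R, GRing.rterm t &
    forall e s, GRing.eval (coords c e ++ s) t = u e.

Definition definable E (c : context E) (P : E -> Prop) :=
  exists phi : ord.formula R,
    forall e s, ord.holds (coords c e ++ s) phi <-> P e.

Section Closure.
Variables (E : Type) (c : context E).

Lemma polyfun_const (a : R) : polyfun c (fun=> a).
Proof. by exists (GRing.Const a). Qed.

Lemma polyfunD (u v : E -> R) : polyfun c u -> polyfun c v ->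
  polyfun c (fun e => u e + v e).
Proof.
by move=> [t rt Ht] [t' rt' Ht']; exists (GRing.Add t t') => [|e s] /=;
  rewrite ?rt ?rt' ?Ht ?Ht'.
Qed.

Lemma polyfunM (u v : E -> R) : polyfun c u -> polyfun c v ->
  polyfun c (fun e => u e * v e).
Proof.
by move=> [t rt Ht] [t' rt' Ht']; exists (GRing.Mul t t') => [|e s] /=;
  rewrite ?rt ?rt' ?Ht ?Ht'.
Qed.

Lemma polyfunN (u : E -> R) : polyfun c u -> polyfun c (fun e => - u e).
Proof.
by move=> [t rt Ht]; exists (GRing.Opp t) => [|e s] //=; rewrite Ht.
Qed.

Lemma polyfunX (u : E -> R) n : polyfun c u -> polyfun c (fun e => u e ^+ n).
Proof.
by move=> [t rt Ht]; exists (GRing.Exp t n) => [|e s] //=; rewrite Ht.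
Qed.

Lemma polyfun_sum I (r : seq I) (u : I -> E -> R) :
  (forall i, polyfun c (u i)) -> polyfun c (fun e => \sum_(i <- r) u i e).
Proof.
move=> Hu; elim: r => [|i r IH].
  by exists (GRing.Const 0) => // e s; rewrite big_nil.
have [t rt Ht] := polyfunD (Hu i) IH.
by exists t => // e s; rewrite Ht big_cons.
Qed.

Lemma polyfun_prod I (r : seq I) (u : I -> E -> R) :
  (forall i, polyfun c (u i)) -> polyfun c (fun e => \prod_(i <- r) u i e).
Proof.
move=> Hu; elim: r => [|i r IH].
  by exists (GRing.Const 1) => // e s; rewrite big_nil.
have [t rt Ht] := polyfunM (Hu i) IH.
by exists t => // e s; rewrite Ht big_cons.
Qed.

Lemma polyfun_meval m (p : {mpoly R[m]}) (u : E -> 'rV[R]_m) :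
  (forall i, polyfun c (fun e => u e 0 i)) -> polyfun c (fun e => p.@[u e 0]).
Proof.
move=> Hu.
have [t rt Ht] : polyfun c (fun e =>
    \sum_(k <- msupp p) p@_k * \prod_i u e 0 i ^+ k i).
  apply: polyfun_sum => k; apply: polyfunM; first exact: polyfun_const.
  apply: (@polyfun_prod _ _ (fun (i : 'I_m) e => u e 0 i ^+ k i)) => i.
  exact: polyfunX.
by exists t => // e s; rewrite Ht mevalE.
Qed.

Lemma definable_iff (P Q : E -> Prop) :
  (forall e, P e <-> Q e) -> definable c P -> definable c Q.
Proof. by move=> PQ [f Hf]; exists f => e s; rewrite Hf. Qed.

Lemma definable_eq (u v : E -> R) : polyfun c u -> polyfun c v ->
  definable c (fun e => u e = v e).
Proof.
by move=> [t _ Ht] [t' _ Ht']; exists (ord.Equal t t') => e s /=;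
  rewrite Ht Ht'.
Qed.

Lemma definable_lt (u v : E -> R) : polyfun c u -> polyfun c v ->
  definable c (fun e => u e < v e).
Proof.
by move=> [t _ Ht] [t' _ Ht']; exists (ord.Lt t t') => e s /=; rewrite Ht Ht'.
Qed.

Lemma definable_le (u v : E -> R) : polyfun c u -> polyfun c v ->
  definable c (fun e => u e <= v e).
Proof.
by move=> [t _ Ht] [t' _ Ht']; exists (ord.Le t t') => e s /=; rewrite Ht Ht'.
Qed.

Lemma definable_not (P : E -> Prop) :
  definable c P -> definable c (fun e => ~ P e).
Proof. by move=> [f Hf]; exists (ord.Not f) => e s /=; rewrite Hf. Qed.

Lemma definable_and (P Q : E -> Prop) : definable c P -> definable c Q ->
  definable c (fun e => P e /\ Q e).
Proof.
by move=> [f Hf] [g Hg]; exists (ord.And f g) => e s /=; rewrite Hf Hg.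
Qed.

Lemma definable_or (P Q : E -> Prop) : definable c P -> definable c Q ->
  definable c (fun e => P e \/ Q e).
Proof.
by move=> [f Hf] [g Hg]; exists (ord.Or f g) => e s /=; rewrite Hf Hg.
Qed.

Lemma definable_imply (P Q : E -> Prop) : definable c P -> definable c Q ->
  definable c (fun e => P e -> Q e).
Proof.
by move=> [f Hf] [g Hg]; exists (ord.Implies f g) => e s /=; rewrite Hf Hg.
Qed.

Lemma definable_all T (r : seq T) (b : T -> E -> bool) :
  (forall i, definable c (fun e => b i e)) ->
  definable c (fun e => all (b^~ e) r).
Proof.
move=> Hb; elim: r => [|i r IH]; first by exists (ord.Bool true).
have [f Hf] := definable_and (Hb i) IH; exists f => e s.
by rewrite Hf /=; split=> [[-> ->]//|/andP].
Qed.

Lemma definable_has T (r : seq T) (b : T -> E -> bool) :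
  (forall i, definable c (fun e => b i e)) ->
  definable c (fun e => has (b^~ e) r).
Proof.
move=> Hb; apply: (definable_iff (P := fun e => ~ all (predC (b^~ e)) r)).
  by move=> e; rewrite -[has _ _]negbK -all_predC; split => /negP.
apply: definable_not; apply: (@definable_all _ _ (fun i e => ~~ b i e)) => i.
apply: definable_iff (definable_not (Hb i)) => e; exact: (rwP negP).
Qed.

End Closure.

Section Quantifiers.
Variables (E : Type) (c : context E).

Lemma size_coords_rcons (p : E * R) :
  size (rcons (coords c p.1) p.2) = (ncoords c).+1.
Proof. by rewrite size_rcons size_coords. Qed.

Definition extend : context (E * R) := Context size_coords_rcons.

Lemma size_coords_cat m (p : E * 'rV[R]_m) :
  size (coords c p.1 ++ [seq p.2 0 i | i <- enum 'I_m]) = (ncoords c + m)%N.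
Proof. by rewrite size_cat size_map size_enum_ord size_coords. Qed.

Definition extendv m : context (E * 'rV[R]_m) := Context (@size_coords_cat m).

Lemma polyfun_ext u : polyfun c u -> polyfun extend (fun p => u p.1).
Proof. by move=> [t rt Ht]; exists t => // e s; rewrite /= cat_rcons Ht. Qed.

Lemma polyfun_extv m u : polyfun c u -> polyfun (extendv m) (fun p => u p.1).
Proof. by move=> [t rt Ht]; exists t => // e s; rewrite /= -catA Ht. Qed.

Lemma polyfun_var : polyfun extend (fun p => p.2).
Proof.
exists (GRing.Var R (ncoords c)) => // e s /=.
by rewrite cat_rcons nth_cat size_coords ltnn subnn.
Qed.

Lemma polyfun_varv m i : polyfun (extendv m) (fun p => p.2 0 i).
Proof.
exists (GRing.Var R (ncoords c + i)) => // e s /=.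
rewrite -catA nth_cat size_coords ltnNge leq_addr /= addKn nth_cat.
rewrite size_map size_enum_ord ltn_ord.
by rewrite (nth_map i) ?size_enum_ord // nth_ord_enum.
Qed.

Lemma definable_exists (P : E -> R -> Prop) :
  definable extend (fun p => P p.1 p.2) -> definable c (fun e => exists x,
    P e x).
Proof.
(* The bound variable takes the first index after the context, so the quantifier overwrites the head
   of the suffix [s], which evaluation ignores. *)
move=> [f Hf]; exists (ord.Exists (ncoords c) f) => e s /=.
suff H x : ord.holds (set_nth 0 (coords c e ++ s) (ncoords c) x) f <-> P e x.
  by split=> -[x /H Px]; exists x.
have := Hf (e, x) (behead s); rewrite /= => <-.
suff -> : set_nth 0 (coords c e ++ s) (ncoords c) x =
  rcons (coords c e) x ++ behead s by [].
rewrite -(size_coords c e); elim: (coords c e) => [|a l IH] /=;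
  first by case: s.
by rewrite IH.
Qed.

Lemma definable_forall (P : E -> R -> Prop) :
  definable extend (fun p => P p.1 p.2) -> definable c (fun e => forall x,
    P e x).
Proof.
move=> dP; apply: definable_iff
  (definable_not (definable_exists (P :=
    fun e x => ~ P e x) (definable_not dP))).
by move=> e; rewrite -forallNP; split=> H x; [exact: contrapT|move/(_ (H x))].
Qed.
End Quantifiers.

Lemma definable_existsv m E (c : context E) (P : E -> 'rV[R]_m -> Prop) :
  definable (extendv c m) (fun p => P p.1 p.2) ->
  definable c (fun e => exists x, P e x).
Proof.
move=> [f Hf].
have {}Hf e s (x : 'rV[R]_m) :
    ord.holds (coords c e ++ [seq x 0 i | i <- enum 'I_m] ++ s) f <-> P e x.
  by rewrite catA; exact: (Hf (e, x) s).
(* Bind [k] variables one at a time, the last coordinate innermost. They overwrite the first [k]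
   entries of the suffix, which leaves [drop k s]. *)
suff gen (k : nat) (f' : ord.formula R) : exists g, forall (l s : seq R),
  size l = ncoords c ->
    ord.holds (l ++ s) g <->
    exists2 r, size r = k & ord.holds (l ++ r ++ drop k s) f'.
  have [g Hg] := gen m f; exists g => e s.
  rewrite (Hg _ _ (size_coords c e)); split=> [[r sr]|[x Px]].
    pose x : 'rV[R]_m := \row_i nth 0 r i.
    suff -> : r = [seq x 0 i | i <- enum 'I_m] by move/Hf => Px; exists x.
    apply: (@eq_from_nth _ 0) => [|i]; rewrite sr;
      first by rewrite size_map size_enum_ord.
    move=> im; rewrite (nth_map (Ordinal im)) ?size_enum_ord //.
    by rewrite mxE nth_enum_ord.
  exists [seq x 0 i | i <- enum 'I_m]; first by rewrite size_map size_enum_ord.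
  exact/Hf.
elim: k f' => [|k IH] f'.
  exists f' => l s _; split=> [H|[r /size0nil ->]]; last by rewrite drop0.
  by exists [::] => //; rewrite drop0.
have [g Hg] := IH (ord.Exists (ncoords c + k) f').
exists g => l s sl; rewrite Hg //; clear Hg IH.
have set_nthE (r : seq R) x : size r = k ->
    set_nth 0 (l ++ r ++ drop k s) (ncoords c + k) x =
    l ++ rcons r x ++ drop k.+1 s.
  move=> <-; rewrite -sl; elim: l {sl} => [|a l IHl] /=; last by rewrite IHl.
  rewrite add0n -add1n -drop_drop drop1.
  elim: r (drop _ s) => [|b r IHr] q; first by case: q.
  by rewrite /= IHr.
split=> [[r sr [x]]|[]].
  by rewrite set_nthE // => H; exists (rcons r x); rewrite ?size_rcons ?sr.
case/lastP => [//|r x]; rewrite size_rcons => -[sr] H.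
by exists r => //; exists x; rewrite set_nthE.
Qed.

Lemma definable_forallv m E (c : context E) (P : E -> 'rV[R]_m -> Prop) :
  definable (extendv c m) (fun p => P p.1 p.2) ->
  definable c (fun e => forall x, P e x).
Proof.
move=> dP; apply: definable_iff (definable_not
  (definable_existsv (P := fun e x => ~ P e x) (definable_not dP))).
by move=> e; rewrite -forallNP; split=> H x; [exact: contrapT|move/(_ (H x))].
Qed.

(* Quantifying over all contexts makes these notions stable under substitution
   of polynomial functions. *)
Definition definable1 (A : R -> Prop) := forall E (c : context E) (u : E -> R),
  polyfun c u -> definable c (fun e => A (u e)).

Definition definable2 (A : R -> R -> Prop) :=
  forall E (c : context E) (u v : E -> R),
  polyfun c u -> polyfun c v -> definable c (fun e => A (u e) (v e)).

Definition definablev m (A : 'rV[R]_m -> Prop) :=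
  forall E (c : context E) (u : E -> 'rV[R]_m),
  (forall i, polyfun c (fun e => u e 0 i)) -> definable c (fun e => A (u e)).

Definition definable1v m (A : R -> 'rV[R]_m -> Prop) :=
  forall E (c : context E) (v : E -> R) (u : E -> 'rV[R]_m),
  polyfun c v -> (forall i, polyfun c (fun e => u e 0 i)) ->
  definable c (fun e => A (v e) (u e)).

Lemma semialgebraic_definablev m (A : set 'rV[R]_m) :
  semialgebraic_set A -> definablev A.
Proof.
move=> [cs ->] E c u Hu.
pose b (d : seq {mpoly R[m]} * seq {mpoly R[m]}) (e : E) :=
  all (fun p => p.@[u e 0] == 0) d.1 && all (fun q => 0 < q.@[u e 0]) d.2.
apply: (definable_iff (P := fun e => has (b^~ e) cs)).
  move=> e; split=> [/hasP[d dcs bd]|[d dcs bd]]; first by exists d.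
  by apply/hasP; exists d.
apply: definable_has => d; apply: (definable_iff (P := fun e =>
  all (fun p => p.@[u e 0] == 0) d.1 /\ all (fun q => 0 < q.@[u e 0]) d.2)).
  by move=> e; exact: (rwP andP).
apply: definable_and.
  apply: (@definable_all _ _ _ _ (fun p e => p.@[u e 0] == 0)) => p.
  apply: (definable_iff (P := fun e => p.@[u e 0] = 0)).
    by move=> e; exact: (rwP eqP).
  by apply: definable_eq; [exact: polyfun_meval|exact: polyfun_const].
apply: (@definable_all _ _ _ _ (fun p e => 0 < p.@[u e 0])) => p.
by apply: definable_lt; [exact: polyfun_const|exact: polyfun_meval].
Qed.

End Definability.

(** * One-sided dichotomy *)

Section Dichotomy.
Variable R : realType.

Lemma near0P (P : R -> Prop) : (\forall t \near 0^'+, P t) <->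
  exists2 d, 0 < d & forall t, 0 < t -> t < d -> P t.
Proof.
split=> [[d /= d0 H]|[d d0 H]].
  exists d => // t t0 td; apply: H => //=.
  by rewrite sub0r normrN gtr0_norm.
by near=> t; apply: H; near: t; [exact: nbhs_right_gt|exact: nbhs_right_lt].
Unshelve. all: by end_near. Qed.

Lemma rterm_poly (t : GRing.term R) : GRing.rterm t ->
  exists p : {poly R}, forall x, GRing.eval [:: x] t = p.[x].
Proof.
move=> rt; exists (eval_poly [::] (abstrX 0 (to_rterm t))) => x.
by rewrite abstrXP evalE to_rtermE.
Qed.

(** To the right of [0], a nonzero polynomial has the sign [sgp_right p 0] until its next root. *)
Lemma poly_sg_right (p : {poly R}) :
  exists s, \forall t \near 0^'+, Num.sg p.[t] = s.
Proof.
have [->|p0] := eqVneq p 0.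
  by exists 0; near=> t; rewrite horner0 sgr0.
exists (sgp_right p 0); apply/near0P.
exists (next_root p 0 1); first exact: next_root_gt.
by move=> t t0 t1; apply: (@sgr_neighpr _ 1); rewrite /neighpr in_itv /= t0.
Unshelve. all: by end_near. Qed.

Lemma qf_near_right (f : ord.formula R) : ord.qf_form f -> ord.rformula f ->
  exists b, \forall t \near 0^'+, ord.qf_eval [:: t] f = b.
Proof.
have sub (t1 t2 : GRing.term R) : GRing.rterm t1 -> GRing.rterm t2 ->
    exists s, \forall t \near 0^'+,
    Num.sg (GRing.eval [:: t] t1 - GRing.eval [:: t] t2) = s.
  move=> /rterm_poly[p Hp] /rterm_poly[q Hq].
  have [s Hs] := poly_sg_right (p - q); exists s.
  by apply: filterS Hs => t; rewrite Hp Hq hornerD hornerN.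
elim: f => //=.
- by move=> b _ _; exists b; near=> t.
- move=> t1 t2 _ /andP[r1 r2]; have [s Hs] := sub _ _ r1 r2; exists (s == 0).
  by apply: filterS Hs => t <-; rewrite sgr_eq0 subr_eq0.
- move=> t1 t2 _ /andP[r1 r2]; have [s Hs] := sub _ _ r2 r1; exists (0 < s).
  by apply: filterS Hs => t <-; rewrite sgr_gt0 subr_gt0.
- move=> t1 t2 _ /andP[r1 r2]; have [s Hs] := sub _ _ r2 r1; exists (0 <= s).
  by apply: filterS Hs => t <-; rewrite sgr_ge0 subr_ge0.
- move=> f IHf g IHg /andP[qf qg] /andP[rf rg].
  have [a Ha] := IHf qf rf; have [b Hb] := IHg qg rg; exists (a && b).
  by apply: filterS2 Ha Hb => t -> ->.
- move=> f IHf g IHg /andP[qf qg] /andP[rf rg].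
  have [a Ha] := IHf qf rf; have [b Hb] := IHg qg rg; exists (a || b).
  by apply: filterS2 Ha Hb => t -> ->.
- move=> f IHf g IHg /andP[qf qg] /andP[rf rg].
  have [a Ha] := IHf qf rf; have [b Hb] := IHg qg rg; exists (a ==> b).
  by apply: filterS2 Ha Hb => t -> ->.
- move=> f IHf qf rf; have [a Ha] := IHf qf rf; exists (~~ a).
  by apply: filterS Ha => t ->.
Unshelve. all: by end_near. Qed.

Lemma size_seq1 (t : R) : size [:: t] = 1%N.
Proof. by []. Qed.

(* After quantifier elimination, [A] is a boolean combination of sign conditions
   on univariate polynomials, each of constant sign to the right of [0]. *)
Lemma definable1_near_right (A : R -> Prop) : definable1 A ->
  (\forall t \near 0^'+, A t) \/ (\forall t \near 0^'+, ~ A t).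
Proof.
move=> dA; pose c := Context size_seq1.
have pc : polyfun c id by exists (GRing.Var R 0).
have [f Hf] := dA _ c _ pc.
have rf := ord.to_rform_rformula f.
have wf : forall i bc, ord.dnf_rterm (ord.w_to_oclause bc) ->
  ord.qf_form (wproj i bc) && ord.rformula (wproj i bc) :=
  @wf_QE_wproj R.
have /andP[qq rq] := ord.quantifier_elim_wf wf rf.
have [b Hb] := qf_near_right qq rq.
have AE t : ord.qf_eval [:: t] (ord.quantifier_elim (@wproj R) (ord.to_rform f))
    <-> A t.
  rewrite -(Hf t [::]) -ord.to_rformP; apply: iff_sym; apply: rwP.
  exact: (ord.quantifier_elim_rformP wf (@valid_QE_wproj R)).
case: b Hb => Hb; [left|right]; apply: filterS Hb => t Ht; rewrite -AE.
  by rewrite Ht.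
by rewrite Ht.
Qed.

End Dichotomy.

(** * Definable choice *)

Section Choice.
Variable R : realType.

(* The least element of [A] if there is one, and otherwise the midpoint of the
   leftmost maximal interval contained in [A]. *)
Definition pick (A : R -> Prop) (y : R) :=
  (A y /\ forall z, A z -> y <= z) \/
  exists a, exists b, a < b /\ (y + y = a + b /\ ((forall z, A z -> a < z) /\
    ((forall z, a < z -> z < b -> A z) /\
     (forall b', b < b' -> exists z, a < z /\ (z < b' /\ ~ A z))))).

Lemma pick_mem A y : pick A y -> A y.
Proof.
case=> [[]//|[a [b [ab [yab [_ [H _]]]]]]].
by apply: H; move: ab yab; lra.
Qed.

(** An interval in [A] whose left end lies strictly below all of [A] leaves no room for a least
    element, so the two alternatives of [pick] exclude each other. Two such intervals have the same
    left end, and maximality makes the right ends agree. *)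
Lemma pick_unique A y y' : pick A y -> pick A y' -> y = y'.
Proof.
wlog : y y' / y <= y' => [hw py py'|].
  by case: (leP y y') => [/hw|/ltW/hw H]; [exact|apply/esym/H].
move=> yy' [[Ay my]|[a [b [ab [yab [la [sb mb]]]]]]]
  [[Ay' my']|[a' [b' [ab' [yab' [la' [sb' mb']]]]]]].
- by apply/le_anti; rewrite my ?my'.
- have ay := la' _ Ay.
  suff /my : A ((a' + Num.min b' y) / 2).
    by case: (leP b' y); move: ay ab' yab' yy'; lra.
  by apply: sb'; case: (leP b' y); move: ay ab' yab' yy'; lra.
- have ay := la _ Ay'.
  suff /my' : A ((a + Num.min b y') / 2).
    by case: (leP b y'); move: ay ab yab yy'; lra.
  by apply: sb; case: (leP b y'); move: ay ab yab yy'; lra.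
- have aa u v (uv : u < v) w : (forall z, u < z -> z < v -> A z) ->
      (forall z, A z -> w < z) -> w <= u.
    move=> suv lw; rewrite leNgt; apply/negP => uw.
    have /lw : A ((u + Num.min v w) / 2).
      by apply: suv; case: (leP v w); move: uv uw; lra.
    by case: (leP v w); move: uv uw; lra.
  have eqa : a = a'.
    by apply/le_anti; rewrite (aa _ _ ab' _ sb' la) (aa _ _ ab _ sb la').
  subst a'; suff eqb : b = b' by subst b'; move: yab yab'; lra.
  apply/le_anti/andP; split; rewrite leNgt; apply/negP.
    by move=> /mb'[z [az [zb nAz]]]; apply: nAz; exact: sb.
  by move=> /mb[z [az [zb nAz]]]; apply: nAz; exact: sb'.
Qed.

(** If [inf A] is not attained, the one-sided dichotomy says that [A] contains or misses an interval
    just to the right of [inf A]. Missing one contradicts the infimum; otherwise the supremum of the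
    admissible right ends, finite by the bound [M], gives the maximal interval. *)
Lemma pick_exists (A : R -> Prop) M : (exists y, A y) ->
  (forall y, A y -> `|y| <= M) -> (forall a, definable1 (fun s => A (a + s))) ->
  exists y, pick A y.
Proof.
move=> [y0 Ay0] AM dA; pose a := inf A.
have lA : has_lbound A by exists (- M) => z /AM; rewrite ler_norml => /andP[].
have [Aa|nAa] := pselect (A a).
  by exists a; left; split=> // z Az; exact: ge_inf.
have la z : A z -> a < z by move=> Az; exact: inf_lb_strict.
case: (definable1_near_right (dA a)) => /near0P[d d0 Hd]; last first.
  have Ane : A !=set0 by exists y0.
  have ad : inf A < a + d by rewrite ltrDl.
  have [y Ay ya] := inf_lt Ane ad.
  have ay := la _ Ay.
  by case: (Hd (y - a)); rewrite ?subr_gt0 ?ltrBlDl // subrKC.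
pose S := [set b | a < b /\ forall z, a < z -> z < b -> A z].
have Sd : S (a + d).
  split=> [|z az zd]; first by rewrite ltrDl.
  by rewrite -(subrKC a z); apply: Hd; rewrite ?subr_gt0 ?ltrBlDl.
have S0 : S !=set0 by exists (a + d).
have uS : ubound S (Num.max a M).
  move=> b [ab sb]; rewrite leNgt; apply/negP => Mb.
  have am : a <= Num.max a M by rewrite le_max lexx.
  have MM : M <= Num.max a M by rewrite le_max lexx orbT.
  have /AM : A ((Num.max a M + b) / 2) by apply: sb; move: Mb am; lra.
  by have := ler_norm ((Num.max a M + b) / 2); move: Mb am MM; lra.
have hS : has_ubound S by exists (Num.max a M).
exists ((a + sup S) / 2); right; exists a, (sup S).
have ab : a < sup S by apply: (@lt_le_trans _ _ (a + d));
  [rewrite ltrDl|exact: ub_le_sup].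
split=> //; split; first by lra.
split=> //; split=> [z az zb|b' bb'].
  by have [y [_ Sy] zy] := sup_gt S0 zb; exact: Sy.
apply: contrapT => H; suff /(ub_le_sup hS) : S b' by rewrite leNgt bb'.
split=> [|z az zb]; first exact: lt_trans bb'.
by apply: contrapT => nAz; apply: H; exists z.
Qed.

End Choice.

(** Putting [0] for the last variable recovers a function on the smaller context; the [refine]
    typechecks only if [f] does not depend on that variable. *)
Ltac weaken_polyfun :=
  match goal with
  | |- polyfun (extend ?c) ?f =>
    refine (@polyfun_ext _ _ c (fun e => f (e, 0)) _); cbv beta; cbn [fst snd]
  | |- polyfun (@extendv _ _ ?c _) ?f =>
    refine (@polyfun_extv _ _ c _ (fun e => f (e, 0)) _); cbv beta;
      cbn [fst snd]
  end.

Ltac solve_polyfun := solve [repeat first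
  [ assumption
  | match goal with H : forall i, polyfun _ _ |- _ => apply H end
  | apply polyfun_const | apply polyfun_var | apply polyfun_varv
  | weaken_polyfun
  | apply polyfunD | apply polyfunN | apply polyfunM | apply polyfunX
  | apply polyfun_sum; intros ? ]].

Ltac definability := repeat first
  [ match goal with
    | H : definable1 _ |- _ => apply H; solve_polyfun
    | H : definable2 _ |- _ => apply H; solve_polyfun
    | H : definablev _ |- _ => apply H; intros ?; solve_polyfun
    | H : definable1v _ |- _ => apply H; [solve_polyfun|intros ?; solve_polyfun]
    end
  | apply definable_and | apply definable_or | apply definable_not
  | apply definable_imply
  | apply definable_exists; cbv beta | apply definable_existsv; cbv beta
  | apply definable_forall; cbv beta | apply definable_forallv; cbv beta
  | apply definable_lt; [solve_polyfun|solve_polyfun]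
  | apply definable_le; [solve_polyfun|solve_polyfun]
  | apply definable_eq; [solve_polyfun|solve_polyfun]].

Section CurveSelection.
Variable R : realType.

Lemma definable_pick_coord m (D : R -> 'rV[R]_m -> Prop) j : definable1v D ->
  definable1v (fun t z => D t z /\
    pick (fun y => exists w, D t w /\ w 0 j = y) (z 0 j)).
Proof. by move=> dD E c v u dv du; rewrite /pick; definability. Qed.

(** Coordinates are made unique one after the other by applying [pick] to the set of values of each;
    this set is bounded by [B t], as [pick_exists] requires. *)
Lemma definable_choice m (D : R -> 'rV[R]_m -> Prop) (B : R -> R) :
  definable1v D -> (forall t z i, D t z -> `|z 0 i| <= B t) ->
  exists D', [/\ definable1v D', forall t z, D' t z -> D t z,
    forall t, (exists z, D t z) -> exists z, D' t z &
    forall t z w, D' t z -> D' t w -> z = w].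
Proof.
move=> dD DB.
(* [s] lists the coordinates that are already determined by [t]. *)
suff /(_ (enum 'I_m))[D' [dD' sD' eD' uD']] (s : seq 'I_m) :
    exists D', [/\ definable1v D', forall t z, D' t z -> D t z,
    forall t, (exists z, D t z) -> exists z, D' t z &
    forall t z w j, j \in s -> D' t z -> D' t w -> z 0 j = w 0 j].
  exists D'; split=> // t z w Dz Dw; apply/rowP => j.
  by apply: (uD' t) => //; rewrite mem_enum.
elim: s => [|j s [D1 [dD1 sD1 eD1 uD1]]]; first by exists D; split.
exists (fun t z => D1 t z /\
  pick (fun y => exists w, D1 t w /\ w 0 j = y) (z 0 j)); split.
- exact: definable_pick_coord.
- by move=> t z [/sD1].
- move=> t /eD1[z0 Dz0].
  have [||a|y py] := @pick_exists _ (fun y => exists w,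
    D1 t w /\ w 0 j = y) (B t).
  + by exists (z0 0 j), z0.
  + by move=> y [w [/sD1 Dw <-]]; exact: DB.
  + move=> E c u du.
    definability.
  + by have [z [Dz zy]] := pick_mem py; exists z; rewrite zy.
- move=> t z w i; rewrite inE => /orP[/eqP->|si] [Dz pz] [Dw pw].
    exact: pick_unique pz pw.
  exact: (uD1 t).
Qed.

End CurveSelection.

(** * Monotonicity of definable functions *)

Section LocalMonotonicity.
Variable R : realType.
Implicit Types g u : R -> R.

(** Let [c] be the supremum of the points up to which [g] is at most [g a]. The hypothesis on the
    left of [c] extends the bound to [c], and the one on the right extends it beyond [c] unless
    [c = b]. *)
Lemma nonincreasing_of_local g (a b : R) : a < b ->
  (forall t, a < t <= b -> \forall e \near 0^'+, g t <= g (t - e)) ->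
  (forall t, a <= t < b -> \forall e \near 0^'+, g (t + e) <= g t) ->
  g b <= g a.
Proof.
move=> ab gl gr.
pose S := [set x | a <= x <= b /\ forall y, a <= y <= x -> g y <= g a].
have Sa : S a.
  split=> [|y /andP[ay ya]]; first by rewrite lexx ltW.
  by have -> : y = a by apply/le_anti; rewrite ay ya.
have uS : has_ubound S by exists b => x [/andP[]].
have [c cE] : exists c, c = sup S by exists (sup S).
have ac : a <= c by rewrite cE; exact: ub_le_sup.
have cb : c <= b by rewrite cE; apply: ge_sup; [exists a|move=> x [/andP[]]].
have ltc y : a <= y -> y < c -> g y <= g a.
  move=> ay; rewrite cE => yc;
    have [z [_ Sz] yz] := @sup_gt R S y (ex_intro _ _ Sa) yc.
  by apply: Sz; rewrite ay ltW.
have gc : g c <= g a.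
  have [->//|nac] := eqVneq a c.
  have {}ac : a < c by rewrite lt_neqAle nac.
  have /near0P[d d0 Hd] := gl c (introT andP (conj ac cb)).
  have [e [e0 ed eac]] : exists e, [/\ 0 < e, e < d & e <= c - a].
    by exists (Num.min d (c - a) / 2); case: (leP d (c - a)); split; lra.
  apply: le_trans (Hd _ e0 ed) (ltc _ _ _); lra.
have [->|ncb] := eqVneq b c; first by [].
have {}cb : c < b by rewrite lt_neqAle eq_sym ncb.
have /near0P[d d0 Hd] := gr c (introT andP (conj ac cb)).
have [e [e0 ed ecb]] : exists e, [/\ 0 < e, e < d & e <= b - c].
  by exists (Num.min d (b - c) / 2); case: (leP d (b - c)); split; lra.
suff /(ub_le_sup uS) : S (c + e) by rewrite -cE; lra.
split=> [|y /andP[ay yce]]; first by apply/andP; split; lra.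
have [yc|cy|->//] := ltgtP y c; first exact: ltc.
rewrite -(subrKC c y); apply: le_trans gc; apply: Hd; lra.
Qed.

(* Rationals [p < t < q] inside the two one-sided neighbourhoods would determine
   [t], so the interval would be countable. *)
Lemma no_local_strict_minima g (r : R) : 0 < r ->
  ~ (forall t, 0 < t < r -> (\forall e \near 0^'+, g t <= g (t - e)) /\
       (\forall e \near 0^'+, g t < g (t + e))).
Proof.
move=> r0 H.
have ratH t : exists pq : rat * rat, 0 < t < r ->
    [/\ ratr pq.1 < t, t < ratr pq.2,
    forall s, ratr pq.1 < s -> s < t -> g t <= g s &
    forall s, t < s -> s < ratr pq.2 -> g t < g s].
  have [/H[/near0P[d d0 Hd] /near0P[d' d'0 Hd']]|] := boolP (0 < t < r);
    last first.
    by exists (0, 0).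
  have td : t - d < t by rewrite gtrDl oppr_lt0.
  have td' : t < t + d' by rewrite ltrDl.
  have [p] := rat_in_itvoo td; rewrite in_itv => /= /andP[p1 p2].
  have [q] := rat_in_itvoo td'; rewrite in_itv => /= /andP[q1 q2].
  exists (p, q) => _; split=> //= s s1 s2.
    by rewrite -(subKr t s); apply: Hd; lra.
  by rewrite -(subrKC t s); apply: Hd'; lra.
have [f Hf] := choice ratH.
have f_inj : {in [set t | 0 < t < r] &, injective f}.
  move=> s t; rewrite !inE /= => s0r t0r fst.
  wlog st : s t s0r t0r fst / s < t.
    move=> hw; have [st|ts|//] := ltgtP s t; first exact: hw.
    exact/esym/hw.
  (* With common rationals, [t] lies in the right neighbourhood of [s] and [s] in the left one of
     [t], so [g s < g t <= g s]. *)
  have [s1 s2 s3 s4] := Hf s s0r; have [t1 t2 t3 t4] := Hf t t0r.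
  have := s4 t st; rewrite fst => /(_ t2).
  by have := t3 s; rewrite -fst => /(_ s1 st); lra.
have cI : countable [set t | 0 < t < r].
  apply/countable_injP; exists (pickle \o f) => s t s0r t0r /= fst.
  exact/f_inj/(pcan_inj pickleK).
(* The interval has Lebesgue measure [r > 0], whereas a countable set has measure zero. *)
have := countable_lebesgue_measure0 cI.
have -> : [set t : R | 0 < t < r] = [set` `]0, r[].
  by apply/seteqP; split=> t /=; rewrite in_itv.
by rewrite lebesgue_measure_itv /= lte_fin r0 sube0 => -[r00];
  rewrite r00 ltxx in r0.
Qed.

Section DefinableFunction.
Variables (g : R -> R) (G : R -> R -> Prop) (r : R).
Hypothesis dG : definable2 G.
Hypothesis r_gt0 : 0 < r.
Hypothesis GE : forall t, 0 < t < r -> forall y, G t y <-> y = g t.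

(** Definability is assumed of the graph [G], so the comparison of values of [g] is expressed
    through it. *)
Let lt_graph s t := exists y, exists y', G s y /\ (G t y' /\ y < y').

Let lt_graphE s t : 0 < s < r -> 0 < t < r -> lt_graph s t <-> g s < g t.
Proof.
move=> s0r t0r; split=> [[y [y']]|st].
  by rewrite (GE s0r) (GE t0r) => -[-> [->]].
by exists (g s), (g t); rewrite (GE s0r) (GE t0r).
Qed.

Let near_right t : 0 < t < r -> \forall e \near 0^'+, 0 < t + e < r.
Proof.
move=> /andP[t0 tr]; apply/near0P; exists (r - t); first by rewrite subr_gt0.
by move=> e e0 er; apply/andP; split; lra.
Qed.

Let near_left t : 0 < t < r -> \forall e \near 0^'+, 0 < t - e < r.
Proof.
move=> /andP[t0 tr]; apply/near0P; exists t => //.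
by move=> e e0 er; apply/andP; split; lra.
Qed.

Lemma right_dichotomy t : 0 < t < r ->
  (\forall e \near 0^'+, g t < g (t + e)) \/
  (\forall e \near 0^'+, g (t + e) <= g t).
Proof.
move=> t0r.
have d1 : definable1 (fun e => lt_graph t (t + e)).
  by move=> E c v dv; rewrite /lt_graph; definability.
have nr := near_right t0r.
case: (definable1_near_right d1) => H; [left|right];
  apply: filterS2 nr H => e er; rewrite lt_graphE //.
by move/negP; rewrite -leNgt.
Qed.

Lemma left_dichotomy t : 0 < t < r ->
  (\forall e \near 0^'+, g t < g (t - e)) \/
  (\forall e \near 0^'+, g (t - e) <= g t).
Proof.
move=> t0r.
have d1 : definable1 (fun e => lt_graph t (t - e)).
  by move=> E c v dv; rewrite /lt_graph; definability.
have nl := near_left t0r.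
case: (definable1_near_right d1) => H; [left|right];
  apply: filterS2 nl H => e er; rewrite lt_graphE //.
by move/negP; rewrite -leNgt.
Qed.

Let definable_near_lt (s : R) : definable1 (fun t =>
  \forall e \near 0^'+, lt_graph t (t + s * e)).
Proof.
move=> E c v dv; apply: (definable_iff (P := fun x => exists d, 0 < d /\
    forall e, 0 < e -> e < d -> lt_graph (v x) (v x + s * e))).
  by move=> x; rewrite near0P; split=> [[d [d0 H]]|[d d0 H]]; exists d.
by rewrite /lt_graph; definability.
Qed.

(** By the dichotomy, [g] exceeds [g t] just after [t] either for all small [t] or for none. The
    first case would make every small [t] a local minimum, strict from the right, which is excluded.
    In the second, [right_dichotomy] supplies the right-hand condition of
    [nonincreasing_of_local]. *)
Lemma nonincreasing_near_right :
  (forall t, 0 < t < r -> \forall e \near 0^'+, g t <= g (t - e)) ->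
  exists2 r', 0 < r' <= r & forall s t, 0 < s < t -> t < r' -> g t <= g s.
Proof.
move=> gl; have := definable1_near_right (definable_near_lt 1).
case=> /near0P[d d0 Hd].
  have m0 : 0 < Num.min d r by rewrite lt_min d0.
  exfalso; apply: (@no_local_strict_minima g (Num.min d r)) => // t.
  rewrite lt_min => /and3P[t0 td tr].
  have t0r : 0 < t < r by rewrite t0.
  split; first exact: gl.
  have := Hd t t0 td; apply: filterS2 (near_right t0r) => e er.
  by rewrite mul1r lt_graphE.
exists (Num.min d r); first by rewrite lt_min d0 r_gt0 ge_min lexx orbT.
move=> s t /andP[s0 st]; rewrite lt_min => /andP[td tr].
apply: nonincreasing_of_local => // u /andP[].
  by move=> su ut; apply: gl; apply/andP; split; lra.
move=> su ut.
have u0r : 0 < u < r by apply/andP; split; lra.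
case: (right_dichotomy u0r) => // H; exfalso.
apply: (Hd u); [lra|lra|]; apply: filterS2 (near_right u0r) H => e er.
by rewrite mul1r lt_graphE.
Qed.

Lemma left_dichotomy_near_right :
  (\forall t \near 0^'+, \forall e \near 0^'+, g t < g (t - e)) \/
  (\forall t \near 0^'+, \forall e \near 0^'+, g (t - e) <= g t).
Proof.
have r0t : \forall t \near 0^'+, 0 < t < r.
  by apply/near0P; exists r => // t -> ->.
case: (definable1_near_right (definable_near_lt (-1))) => H; [left|right];
  apply: filterS2 r0t H => t t0r Ht.
  by apply: filterS2 (near_left t0r) Ht => e er; rewrite mulN1r lt_graphE.
case: (left_dichotomy t0r) => // H; exfalso; apply: Ht.
by apply: filterS2 (near_left t0r) H => e er; rewrite mulN1r lt_graphE.
Qed.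

End DefinableFunction.

(** Otherwise [g] would be strictly larger just to the left of every small [t], hence nonincreasing
    near [0]. As [0 <= g s <= s], this forces [g] to vanish near [0], where it cannot be strictly
    larger to the left. *)
Lemma nondecreasing_near_right g (G : R -> R -> Prop) r : definable2 G ->
  0 < r ->
  (forall t, 0 < t < r -> forall y, G t y <-> y = g t) ->
  (forall t, 0 < t < r -> 0 <= g t <= t) ->
  \forall t \near 0^'+, \forall e \near 0^'+, g (t - e) <= g t.
Proof.
move=> dG r0 GE gt; case: (left_dichotomy_near_right dG r0 GE) => //.
move=> /near0P[d d0 Hd]; exfalso.
have m0 : 0 < Num.min d r by rewrite lt_min d0.
have GEm t : 0 < t < Num.min d r -> forall y, G t y <-> y = g t.
  by rewrite lt_min => /and3P[t0 _ tr]; apply: GE; rewrite t0.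
have glm t : 0 < t < Num.min d r -> \forall e \near 0^'+, g t <= g (t - e).
  rewrite lt_min => /and3P[t0 td _].
  by apply: filterS (Hd t t0 td) => e /ltW.
have [r' /andP[r'0 r'm] Hr'] := nonincreasing_near_right dG m0 GEm glm.
have g0 t : 0 < t < r' -> g t = 0.
  move=> /andP[t0 tr']; have [t0r] : 0 < t < r /\ t < d.
    by have := lt_le_trans tr' r'm; rewrite lt_min t0 => /andP[-> ->].
  move=> td; have /andP[g0 _] := gt t t0r; apply/le_anti; rewrite g0 andbT.
  rewrite leNgt; apply/negP => gt0.
  have [s [s0 st sg]] : exists s, [/\ 0 < s, s < t & s < g t].
    by exists (Num.min t (g t) / 2); case: (leP t (g t)); split; lra.
  have s0r : 0 < s < r by move: t0r; rewrite s0 => /andP[_]; apply: lt_trans.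
  have /andP[_ gs] := gt s s0r.
  by have := Hr' s t; rewrite s0 st tr' => /(_ isT isT); lra.
have tr' : r' / 2 < r' by lra.
have t0 : 0 < r' / 2 by lra.
have td : r' / 2 < d by have := lt_le_trans tr' r'm; rewrite lt_min => /andP[].
have /near0P[c c0 Hc] := Hd _ t0 td.
have [e [e0 ec er]] : exists e, [/\ 0 < e, e < c & e < r' / 2].
  by exists (Num.min c (r' / 2) / 2); case: (leP c (r' / 2)); split; lra.
have := Hc e e0 ec; rewrite !g0 ?ltxx //; apply/andP; split; lra.
Qed.

End LocalMonotonicity.

(** * Curves of small slope *)

Section SlopeCurve.
Variable R : realType.

Definition l1norm m (z : 'rV[R]_m) := \sum_i `|z 0 i|.

Lemma coord_le_l1norm m (z : 'rV[R]_m) i : `|z 0 i| <= l1norm z.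
Proof. by rewrite /l1norm (bigD1 i) //= lerDl sumr_ge0. Qed.

(** The vector [a] of absolute values is determined by polynomial conditions, which makes the
    l1-norm definable. *)
Lemma l1normP m (z : 'rV[R]_m) s : l1norm z = s <-> exists a : 'rV[R]_m,
  (forall i, 0 <= a 0 i /\ a 0 i ^+ 2 = z 0 i ^+ 2) /\ \sum_i a 0 i = s.
Proof.
split=> [<-|[a [Ha <-]]].
  exists (\row_i `|z 0 i|); split=> [i|];
    first by rewrite mxE real_normK ?num_real.
  by apply: eq_bigr => i _; rewrite mxE.
apply: eq_bigr => i _; have [a0 az] := Ha i.
by rewrite -sqrtr_sqr -az sqrtr_sqr ger0_norm.
Qed.

Lemma definable_forall_fin (I : finType) E (c : context R E) (P : E -> I ->
  Prop) :
  (forall i, definable c (fun e => P e i)) -> definable c (fun e => forall i,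
    P e i).
Proof.
move=> dP; apply: (definable_iff (P :=
  fun e => all (fun i => `[< P e i >]) (enum I))).
  move=> e; split=> [/allP H i|H]; first by apply/asboolP/H; rewrite mem_enum.
  by apply/allP => i _; exact/asboolP.
apply: (@definable_all _ _ _ _ _ (fun i e => `[< P e i >])) => i.
by apply: definable_iff (dP i) => e; split=> /asboolP.
Qed.

Lemma polyfun_subv m E (c : context R E) (u v : E -> 'rV[R]_m) i :
  polyfun c (fun e => u e 0 i) -> polyfun c (fun e => v e 0 i) ->
  polyfun c (fun e => (u e - v e) 0 i).
Proof.
move=> pu pv; have [t rt Ht] := polyfunD pu (polyfunN pv).
by exists t => // e s; rewrite Ht !mxE.
Qed.

Lemma definable_l1norm m E (c : context R E) (u : E -> 'rV[R]_m) (v : E -> R) :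
  (forall i, polyfun c (fun e => u e 0 i)) -> polyfun c v ->
  definable c (fun e => l1norm (u e) = v e).
Proof.
move=> pu pv; apply: definable_iff (fun e => iff_sym (l1normP _ _)) _.
apply: definable_existsv; apply: definable_and; last by definability.
by apply: definable_forall_fin => i; definability.
Qed.

(* [l] is quantified because the l1-norm is definable but not polynomial. *)
Definition slope_small m (Q : 'rV[R]_m -> Prop) j k t (z : 'rV[R]_m) :=
  Q z /\ (l1norm z = t /\ exists d, 0 < d /\
    forall z', Q z' -> forall l, l1norm (z' - z) = l -> l < d ->
      z 0 j - z' 0 j <= k * t * l).

Lemma definable_slope_small m (Q : 'rV[R]_m -> Prop) j k :
  definablev Q -> definable1v (slope_small Q j k).
Proof.
move=> dQ E c v u dv du; rewrite /slope_small.
apply: definable_and; first by definability.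
apply: definable_and; first exact: definable_l1norm.
definability; apply: definable_l1norm; last by solve_polyfun.
by move=> i; apply: polyfun_subv; solve_polyfun.
Qed.

Lemma dist_same_sign (a b : R) : (0 <= a /\ 0 <= b) \/ (a <= 0 /\ b <= 0) ->
  `|a| <= `|b| -> `|a - b| = `|b| - `|a|.
Proof.
case=> -[a0 b0]; first by rewrite (ger0_norm a0) (ger0_norm b0) => ab;
  rewrite ler0_norm; lra.
by rewrite (ler0_norm a0) (ler0_norm b0) => ab; rewrite ger0_norm; lra.
Qed.

Lemma slope_small_curve m (Q : 'rV[R]_m -> Prop) j k : definablev Q -> 0 <= k ->
  (forall eta, 0 < eta -> exists t z, 0 < t < eta /\ slope_small Q j k t z) ->
  \forall t \near 0^'+, exists z, [/\ Q z, l1norm z = t & z 0 j <= k * t ^+ 2].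
Proof.
move=> dQ k0 hex; pose D := slope_small Q j k.
have dD : definable1v D by exact: definable_slope_small.
have [|D' [dD' sD eD uD]] := @definable_choice _ _ D id dD.
  by move=> t z i [_ [<- _]]; exact: coord_le_l1norm.
have dex : definable1 (fun t => exists z, D t z).
  by move=> E c v dv; definability.
(* By hypothesis the definable set of admissible [t] meets every right neighbourhood of [0], so by
   the dichotomy it contains an interval []0, r[]. *)
have [r r0 Hr] : exists2 r, 0 < r & forall t, 0 < t < r -> exists z, D' t z.
  have [|] := definable1_near_right dex => /near0P[r r0 Hr].
    by exists r => // t /andP[t0 tr]; exact/eD/Hr.
  have [t [z [/andP[t0 tr] Dz]]] := hex _ r0.
  by case: (Hr t t0 tr); exists z.
have /choice[z Hz] t : exists w, 0 < t < r -> D' t w.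
  by have [/Hr[w Dw]|] := boolP (0 < t < r); [exists w|exists 0].
have near_r : \forall t \near 0^'+, 0 < t < r.
  by apply/near0P; exists r => // t -> ->.
have zl1 t : 0 < t < r -> l1norm (z t) = t by move/Hz/sD => [_ []].
(* As [D'] is single-valued, the graph of any function of the point [z t] can be expressed through
   [D']. *)
have graphE (F : R -> 'rV[R]_m -> R) t y : 0 < t < r ->
    (exists w, D' t w /\ y = F t w) <-> y = F t (z t).
  move=> t0r; split=> [[w [Dw ->]]|->]; last by exists (z t); split=> //;
    exact: Hz.
  by rewrite (uD t w (z t)) //; exact: Hz.
have near_left (t : R) : 0 < t -> \forall e \near 0^'+, 0 < e < t.
  by move=> t0; apply/near0P; exists t => // e -> ->.
have abs_mono i : \forall t \near 0^'+, \forall e \near 0^'+,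
    `|z (t - e) 0 i| <= `|z t 0 i|.
  pose G t y := exists w, D' t w /\ (0 <= y /\ y ^+ 2 = w 0 i ^+ 2).
  have dG : definable2 G by move=> E c v w dv dw; rewrite /G; definability.
  apply: (@nondecreasing_near_right _ (fun t => `|z t 0 i|) G r) => //.
    move=> t t0r y; rewrite -(graphE (fun _ w => `|w 0 i|)) //.
    split=> -[w [Dw H]]; exists w; split=> //.
      by case: H => y0 yw; rewrite -sqrtr_sqr -yw sqrtr_sqr ger0_norm.
    by rewrite H real_normK ?num_real.
  move=> t t0r; rewrite normr_ge0 /=.
  by rewrite -[leRHS](zl1 t t0r); exact: coord_le_l1norm.
have sign_const i : (\forall t \near 0^'+, 0 <= z t 0 i) \/
    (\forall t \near 0^'+, z t 0 i <= 0).
  have dS : definable1 (fun t => exists w, D' t w /\ 0 <= w 0 i).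
    by move=> E c v dv; definability.
  case: (definable1_near_right dS) => H; [left|right];
    apply: filterS2 near_r H => t t0r.
    by case=> w [Dw]; rewrite (uD t w (z t)) //; exact: Hz.
  move=> H; rewrite leNgt; apply/negP => /ltW zt; apply: H.
  by exists (z t); split=> //; exact: Hz.
have coord_mono i : \forall t \near 0^'+, \forall e \near 0^'+,
    `|z (t - e) 0 i - z t 0 i| = `|z t 0 i| - `|z (t - e) 0 i|.
  case: (sign_const i) => /near0P[d d0 Hd];
    have /near0P[d' d'0 Hd'] := abs_mono i;
    apply/near0P; exists (Num.min d d'); rewrite ?lt_min ?d0 // => t t0;
    rewrite lt_min => /andP[td td'];
    apply: filterS2 (near_left t t0) (Hd' t t0 td') => e /andP[e0 et].
    apply: dist_same_sign; left; split; apply: Hd; lra.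
  apply: dist_same_sign; right; split; apply: Hd; lra.
(* The coordinates keep their signs and their absolute values are nondecreasing, so the increments
   add up without cancellation to [t - (t - e)]. *)
have l1_mono : \forall t \near 0^'+, \forall e \near 0^'+,
    l1norm (z (t - e) - z t) = e.
  apply: filterS2 near_r (filter_forall _ coord_mono) => t t0r Ht.
  have /andP[t0 tr] := t0r.
  apply: filterS2 (near_left t t0) (filter_forall _ Ht) => e /andP[e0 et] He.
  have te0r : 0 < t - e < r by apply/andP; split; lra.
  rewrite /l1norm; under eq_bigr do rewrite !mxE He.
  rewrite sumrB; have := zl1 _ t0r; have := zl1 _ te0r.
  by rewrite /l1norm => -> ->; lra.
pose h t := z t 0 j - k * t ^+ 2.
(* Apply the slope bound at [z t] to the curve point [z (t - e)]: going back, the height drops by at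
   most [k * t * e], and [t ^+ 2 - (t - e) ^+ 2] exceeds [t * e] by [e * (t - e)]. *)
have h_mono : \forall t \near 0^'+, \forall e \near 0^'+, h t <= h (t - e).
  apply: filterS2 near_r l1_mono => t t0r Ht.
  have [_ [_ [d [d0 Hd]]]] := sD _ _ (Hz t t0r).
  have /andP[t0 tr] := t0r.
  have ed : \forall e \near 0^'+, e < d by exact: nbhs_right_lt.
  apply: filterS3 (near_left t t0) ed Ht => e /andP[e0 et] ed' Hl.
  have te0r : 0 < t - e < r by apply/andP; split; lra.
  have [Qte _] := sD _ _ (Hz _ te0r).
  have := Hd _ Qte _ Hl ed'; rewrite /h => hle.
  have : 0 <= k * (e * (t - e)) by rewrite !mulr_ge0 //; lra.
  nra.
have [r1 r10 Hr1] := (near0P _).1 h_mono.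
pose r2 := Num.min r r1.
have r20 : 0 < r2 by rewrite lt_min r0.
pose G t y := exists w, D' t w /\ y = w 0 j - k * t ^+ 2.
have dG : definable2 G by move=> E c v w dv dw; rewrite /G; definability.
have GE t : 0 < t < r2 -> forall y, G t y <-> y = h t.
  rewrite lt_min => /and3P[t0 tr _] y.
  by apply: (graphE (fun t w => w 0 j - k * t ^+ 2)); rewrite t0.
have [|r3 /andP[r30 r32] Hr3] := nonincreasing_near_right dG r20 GE.
  by move=> t; rewrite lt_min => /and3P[t0 _ tr]; exact: Hr1.
apply/near0P; exists r3 => // t t0 tr3.
have t0r : 0 < t < r.
  by have := lt_le_trans tr3 r32; rewrite lt_min t0 => /andP[-> _].
have [Qt _] := sD _ _ (Hz t t0r).
exists (z t); split=> //; first exact: zl1.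
rewrite -subr_le0 leNgt; apply/negP => ht.
(* [h] is nonincreasing near [0] and [h s <= s], so a positive value [h t] is contradicted at any
   [s < h t] to the left of [t]. *)
have [s [s0 st sh]] : exists s, [/\ 0 < s, s < t & s < h t].
  by rewrite -/(h t) in ht; exists (Num.min t (h t) / 2); case: (leP t (h t));
    split; lra.
have s0r : 0 < s < r by move: t0r; rewrite s0 => /andP[_]; apply: lt_trans.
have := Hr3 s t; rewrite s0 st tr3 => /(_ isT isT).
have := coord_le_l1norm (z s) j; rewrite (zl1 s s0r).
have := ler_norm (z s 0 j).
have : 0 <= k * s ^+ 2 by rewrite mulr_ge0 ?sqr_ge0.
rewrite {2}/h; lra.
Qed.

End SlopeCurve.

(** * Norms and normal cones *)

Section Norms.
Variable R : realType.

Lemma l1norm_ge0 m (z : 'rV[R]_m) : 0 <= l1norm z.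
Proof. exact: sumr_ge0. Qed.

Lemma ler_l1normD m (a b : 'rV[R]_m) : l1norm (a + b) <= l1norm a + l1norm b.
Proof.
by rewrite /l1norm -big_split; apply: ler_sum => i _; rewrite mxE ler_normD.
Qed.

Lemma l1normN m (a : 'rV[R]_m) : l1norm (- a) = l1norm a.
Proof. by apply: eq_bigr => i _; rewrite mxE normrN. Qed.

Lemma l1norm_row_mx m1 m2 (a : 'rV[R]_m1) (b : 'rV[R]_m2) :
  l1norm (row_mx a b) = l1norm a + l1norm b.
Proof.
rewrite /l1norm big_split_ord /=; congr (_ + _); apply: eq_bigr => i _.
  by rewrite row_mxEl.
by rewrite row_mxEr.
Qed.

Lemma edot_ge0 m (x : 'rV[R]_m) : 0 <= edot x x.
Proof. by apply: sumr_ge0 => i _; rewrite -expr2 sqr_ge0. Qed.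

Lemma enorm_ge0 m (x : 'rV[R]_m) : 0 <= enorm x.
Proof. exact: sqrtr_ge0. Qed.

Lemma sqr_enorm m (x : 'rV[R]_m) : enorm x ^+ 2 = edot x x.
Proof. by rewrite sqr_sqrtr ?edot_ge0. Qed.

Lemma coord_le_enorm m (x : 'rV[R]_m) i : `|x 0 i| <= enorm x.
Proof.
rewrite -sqrtr_sqr ler_wsqrtr // /edot (bigD1 i) //= expr2 lerDl.
by apply: sumr_ge0 => j _; rewrite -expr2 sqr_ge0.
Qed.

Lemma enorm_le_l1norm m (x : 'rV[R]_m) : enorm x <= l1norm x.
Proof.
rewrite -(ger0_norm (l1norm_ge0 x)) -sqrtr_sqr ler_wsqrtr // expr2.
rewrite {1}/l1norm mulr_suml; apply: ler_sum => i _.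
rewrite -expr2 -real_normK ?num_real // expr2 ler_wpM2l //.
exact: coord_le_l1norm.
Qed.

Lemma l1norm_le_enorm m (x : 'rV[R]_m) : l1norm x <= m%:R * enorm x.
Proof.
have -> : m%:R * enorm x = \sum_(i < m) enorm x.
  by rewrite sumr_const card_ord mulr_natl.
by apply: ler_sum => i _; exact: coord_le_enorm.
Qed.

Lemma nbhs_l1normP m (x : 'rV[R]_m) (A : set 'rV[R]_m) : nbhs x A <->
  exists2 e, 0 < e & forall y, l1norm (y - x) < e -> A y.
Proof.
split=> [/nbhs_ballP[e /= e0 He]|[e e0 He]].
  exists e => // y yx; apply: He; split=> // i j; rewrite ord1 /ball /= distrC.
  by have := coord_le_l1norm (y - x) j; rewrite !mxE => /le_lt_trans; apply.
(* The [m] coordinates contribute less than [e] in total; [m.+1] also covers [m = 0]. *)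
have d0 : 0 < e / m.+1%:R by rewrite divr_gt0.
apply/nbhs_ballP; exists (e / m.+1%:R) => // y xy; apply: He.
apply: (@le_lt_trans _ _ (\sum_(i < m) e / m.+1%:R)).
  apply: ler_sum => i _; rewrite !mxE distrC ltW //.
  exact: (xy.2 0 i).
rewrite sumr_const card_ord -[ltLHS]mulr_natr -mulrA gtr_pMr // mulrC.
by rewrite ltr_pdivrMr // mul1r ltr_nat.
Qed.

Lemma cvg_l1normP m (x_ : nat -> 'rV[R]_m) (x : 'rV[R]_m) :
  x_ @ \oo --> x <->
  forall e, 0 < e -> \forall i \near \oo, l1norm (x_ i - x) < e.
Proof.
split=> [cx e e0|H A /nbhs_l1normP[e e0 He]].
  by apply: (cx [set y | l1norm (y - x) < e]); apply/nbhs_l1normP; exists e.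
by apply: filterS (H e e0) => i; exact: He.
Qed.

End Norms.

Section NormalCone.
Variable R : realType.

(** Converts the little-o bound to the l1-norm, in which the curve of small slope is
    parametrised. *)
Lemma frechet_normal_l1norm m (Q : set 'rV[R]_m) z w : Q z ->
  frechet_normal_cone Q z w -> forall eps, 0 < eps -> exists2 d, 0 < d &
    forall y, Q y -> l1norm (y - z) < d ->
      edot w (y - z) <= eps * l1norm (y - z).
Proof.
move=> Qz [o [co Ho]] eps eps0.
have [d d0 Hd] := (nbhs_l1normP z
  [set y | y != z -> Q y -> `|o y / enorm (y - z)| < eps]).1
  (cvgr0_norm_lt _ co eps eps0).
exists d => // y Qy yd.
have [->|yz] := eqVneq y z.
  rewrite subrr {1}/edot big1 => [|i _]; last by rewrite mxE mulr0.
  by rewrite mulr_ge0 ?(ltW eps0) ?l1norm_ge0.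
apply: le_trans (Ho y Qy) _.
have n0 : 0 < enorm (y - z).
  rewrite lt_def enorm_ge0 andbT; apply: contra_neq yz => nyz.
  apply/rowP => i; apply/eqP; rewrite -subr_eq0 -normr_le0 -nyz.
  by have := coord_le_enorm (y - z) i; rewrite !mxE.
have := Hd y yd yz Qy; rewrite normrM normfV (gtr0_norm n0).
rewrite ltr_pdivrMr // => /ltW oy.
apply: le_trans (ler_norm _) (le_trans oy _).
by rewrite ler_wpM2l ?(ltW eps0) // enorm_le_l1norm.
Qed.

Lemma edot_row_mx n (w y : 'rV[R]_(n + 1)) :
  edot w y = \sum_(i < n) w 0 (lshift 1 i) * y 0 (lshift 1 i) +
    w 0 (rshift n ord0) * y 0 (rshift n ord0).
Proof. by rewrite /edot big_split_ord /= big_ord1. Qed.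

(** Write [w = (w', - lam)] and [u = y - z]. The normal inequality bounds [lam] times the drop in
    height by the error term plus [V * l1norm u]; taking [c * lam - V] as the error rate makes the
    sum equal to [c * lam * l1norm u]. *)
Lemma frechet_normal_slope n (Q : set 'rV[R]_(n + 1)) z w V c : 0 <= V -> Q z ->
  frechet_normal_cone Q z w -> (forall i, `|w 0 (lshift 1 i)| <= V) ->
  0 < - w 0 (rshift n ord0) -> V < c * - w 0 (rshift n ord0) ->
  exists2 d, 0 < d & forall y, Q y -> l1norm (y - z) < d ->
    z 0 (rshift n ord0) - y 0 (rshift n ord0) <= c * l1norm (y - z).
Proof.
set j := rshift n ord0; set lam := - w 0 j => V0 Qz Nw wV lam0 Vc.
have eps0 : 0 < c * lam - V by rewrite subr_gt0.
have [d d0 Hd] := frechet_normal_l1norm Qz Nw eps0.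
exists d => // y Qy yd; have := Hd y Qy yd.
rewrite edot_row_mx -/j; set u := y - z; set s := \sum_(i < n) _.
have su : - s <= V * l1norm u.
  apply: le_trans (_ : \sum_(i < n) `|w 0 (lshift 1 i) * u 0 (lshift 1 i)| <=
    _).
    rewrite -sumrN; apply: ler_sum => i _.
    by rewrite -normrN ler_norm.
  apply: (@le_trans _ _ (\sum_(i < n) V * `|u 0 (lshift 1 i)|)).
    by apply: ler_sum => i _; rewrite normrM ler_wpM2r.
  rewrite -mulr_sumr /l1norm big_split_ord /=.
  by rewrite ler_wpM2l // lerDl; apply: sumr_ge0.
have -> : u 0 j = - (z 0 j - y 0 j) by rewrite !mxE opprB.
have -> : w 0 j = - lam by rewrite opprK.
rewrite mulrNN => H.
rewrite -(ler_pM2l lam0); move: H su; lra.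
Qed.

End NormalCone.

(** * Failure of subregularity and points of small slope *)

Section Converse.
Variable R : realType.

(** A limiting normal at [z] is a limit of Frechet normals at nearby points of [Q], and
    [frechet_normal_slope] applies to one that is close enough because the assumed inequalities are
    strict. *)
Lemma limiting_normal_slope_small n (Q : set 'rV[R]_(n + 1)) zbar z w V k eta :
  0 < k -> 0 <= V -> limiting_normal_cone Q z w -> w 0 (rshift n ord0) = -1 ->
  (forall i, `|w 0 (lshift 1 i)| <= V) -> V < k * l1norm (z - zbar) ->
  l1norm (z - zbar) < eta ->
  exists t y, 0 < t < eta /\
    slope_small (fun y => Q (zbar + y)) (rshift n ord0) k t y.
Proof.
set j := rshift n ord0; set L := l1norm (z - zbar).
move=> k0 V0 [z_ [w_ [/cvg_l1normP cz Qz /cvg_l1normP cw Nw]]] wj wV VkL Leta.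
have L0 : 0 <= L by exact: l1norm_ge0.
(* The last condition ensures [V + e < k * (L - e) * (1 - e)]: expand the right-hand side and drop
   [k * e ^+ 2]. *)
have [e [e0 e1 eL ed]] : exists e, [/\ 0 < e, e < 1, e < eta - L &
    e * (1 + k * (1 + L)) < k * L - V].
  pose q := 1 + k * (1 + L).
  have q0 : 0 < q by rewrite addr_gt0 ?mulr_gt0 //; lra.
  pose a := (k * L - V) / q.
  have a0 : 0 < a by rewrite divr_gt0 // subr_gt0.
  have [b [b0 b1 ba]] : exists b, [/\ 0 < b, b < 1 & b < a].
    by exists (Num.min 1 a / 2); case: (leP 1 a); split; lra.
  exists (Num.min b ((eta - L) / 2)); split.
  - by rewrite lt_min b0 divr_gt0 // subr_gt0.
  - by rewrite gt_min b1.
  - by rewrite gt_min [(eta - L) / 2 < _]gtr_pMr ?invf_lt1 ?ltr1n ?orbT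
    ?subr_gt0.
  - by rewrite -ltr_pdivlMr // gt_min ba.
have [i [zi wi]] := filter_ex (filterI (cz e e0) (cw e e0)).
pose y := z_ i - zbar; pose t := l1norm y.
have tL : t <= L + e.
  have := ler_l1normD (z_ i - z) (z - zbar).
  by rewrite addrA subrK -/y -/t -/L; move: zi; lra.
have Lt : L - e <= t.
  have := ler_l1normD (z - z_ i) (z_ i - zbar).
  by rewrite addrA subrK -/y -/t -/L -(opprB (z_ i)) l1normN; move: zi; lra.
have coordw l : `|w_ i 0 l - w 0 l| < e.
  by have := coord_le_l1norm (w_ i - w) l; rewrite !mxE => /le_lt_trans; apply.
have wVi l : `|w_ i 0 (lshift 1 l)| <= V + e.
  have := ler_normD (w_ i 0 (lshift 1 l) - w 0 (lshift 1 l)) (w 0 (lshift 1 l)).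
  by rewrite subrK; have := coordw (lshift 1 l); have := wV l; lra.
have lam1 : 1 - e <= - w_ i 0 j.
  by have := coordw j; rewrite wj opprK ltr_norml => /andP[_]; lra.
have Lbound : V + e < k * (L - e) * (1 - e).
  have : 0 <= k * (e * e) by rewrite !mulr_ge0 // ltW.
  by move: ed; nra.
have Le0 : 0 < L - e.
  rewrite -(pmulr_rgt0 _ k0) -(pmulr_lgt0 _ (_ : 0 < 1 - e)).
    by apply: lt_trans Lbound; rewrite ltr_wpDl.
  by rewrite subr_gt0.
have t0 : 0 < t by exact: lt_le_trans Lt.
have lam0 : 0 < - w_ i 0 j by apply: lt_le_trans lam1; rewrite subr_gt0.
have slope : V + e < k * t * - w_ i 0 j.
  apply: lt_le_trans Lbound _; apply: ler_pM => //.
  - by rewrite mulr_ge0 // ltW.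
  - by rewrite subr_ge0 ltW.
  - by rewrite ler_wpM2l // ltW.
have Ve0 : 0 <= V + e by rewrite addr_ge0 // ltW.
have [d d0 Hd] := frechet_normal_slope Ve0 (Qz i) (Nw i) wVi lam0 slope.
exists t, y; split; first by apply/andP; split=> //; apply: le_lt_trans tL _;
  lra.
split; first by rewrite addrC subrK; exact: Qz.
split=> //; exists d; split=> // y' Qy' l yl ld.
have E : zbar + y' - z_ i = y' - y.
  by apply/rowP => l0; rewrite !mxE; ring.
have := Hd _ Qy'; rewrite E yl => /(_ ld).
by rewrite !mxE; lra.
Qed.

Lemma enorm_subr0 n (x : 'rV[R]_n) : enorm (0 - x) = enorm x.
Proof.
by rewrite /enorm sub0r /edot; under eq_bigr do rewrite mxE mulrNN.
Qed.

Lemma edistance_lt n (S : set 'rV[R]_n) (a : R) : (edistance 0 S < a%:E)%E ->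
  exists2 v, S v & enorm v < a.
Proof.
move=> /ereal_inf_lt[_ [v Sv <-]]; rewrite lte_fin enorm_subr0 => va.
by exists v.
Qed.

Lemma not_subregular_witness n (F : 'rV[R]_n -> set 'rV[R]_n) xbar kappa eps :
  F xbar 0 -> 0 < kappa -> 0 < eps -> ~ strongly_subregular F xbar 0 kappa ->
  exists x v, [/\ eball xbar eps x, F x v & kappa * enorm v < enorm (x - xbar)].
Proof.
move=> F0 k0 e0; apply: contra_notP => H; split=> //; first exact: ltW.
exists eps => // x xe Fx; rewrite leNgt; apply/negP => lt.
have : (edistance 0 (F x) < (enorm (x - xbar) / kappa)%:E)%E.
  by rewrite mulrC EFinM lte_pdivlMl.
move=> /edistance_lt[v Fv vx]; apply: H; exists x, v; split=> //.
by rewrite mulrC -ltr_pdivlMr.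
Qed.

End Converse.

(** * Quadratic growth implies subregularity *)

Section GrowthImpliesSubregularity.
Variable R : realType.

Lemma definablev_translate m (Q : 'rV[R]_m -> Prop) z : definablev Q ->
  definablev (fun y => Q (z + y)).
Proof.
move=> dQ E c u pu; apply: (dQ _ c (fun e => z + u e)) => i.
have [t rt Ht] := polyfunD (polyfun_const c (z 0 i)) (pu i).
by exists t => // e s; rewrite Ht mxE.
Qed.

Lemma cvg_of_enorm_le n (x_ : nat -> 'rV[R]_n) x :
  (forall i, enorm (x_ i - x) <= i.+1%:R^-1) -> x_ @ \oo --> x.
Proof.
move=> H; apply/cvg_l1normP => e e0.
have d0 : 0 < e / n.+1%:R by rewrite divr_gt0.
apply: filterS (near_infty_natSinv_lt (PosNum d0)) => i /= ie.
apply: le_lt_trans (l1norm_le_enorm _) _.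
apply: (@le_lt_trans _ _ (n%:R * (e / n.+1%:R))).
  by rewrite ler_wpM2l // (le_trans (H i)) // ltW.
by rewrite mulrCA gtr_pMr // ltr_pdivrMr // mul1r ltr_nat.
Qed.

Lemma subregular_of_growth n (f : 'rV[R]_n -> \bar R) xbar alpha :
  semialgebraic f -> subdifferentially_continuous f xbar 0 -> 0 < alpha ->
  quadratic_growth f xbar alpha ->
  exists kappa, strongly_subregular (subdifferential f) xbar 0 kappa.
Proof.
move=> sa [sd0 sc] alpha0 [eps eps0 growth].
have fin0 : f xbar \is a fin_num by case: sd0.
pose zbar := row_mx xbar (fine (f xbar))%:M : 'rV[R]_(n + 1).
(* The argument ends with [K * alpha * e ^+ 2 <= 8 * n%:R ^+ 2 * e ^+ 2] for some [e > 0], which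
   this [K] violates; the summand [1] also gives [1 <= K]. *)
pose K := 8 * n%:R ^+ 2 / alpha + 1.
have K1 : 1 <= K by rewrite lerDr divr_ge0 ?(ltW alpha0) // mulr_ge0 // sqr_ge0.
have K0 : 0 < K by exact: lt_le_trans K1.
exists K; apply: contrapT => nsub.
have /choice[xv Hxv] (i : nat) : exists p : 'rV[R]_n * 'rV[R]_n,
    [/\ eball xbar i.+1%:R^-1 p.1, subdifferential f p.1 p.2 &
     K * enorm p.2 < enorm (p.1 - xbar)].
  have i0 : 0 < i.+1%:R^-1 :> R by rewrite invr_gt0.
  by have [x [v H]] := not_subregular_witness sd0 K0 i0 nsub; exists (x, v).
have cx : (fun i => (xv i).1) @ \oo --> xbar.
  by apply: cvg_of_enorm_le => i; have [] := Hxv i.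
have cv : (fun i => (xv i).2) @ \oo --> (0 : 'rV[R]_n).
  apply: cvg_of_enorm_le => i; have [xi _ vx] := Hxv i.
  rewrite subr0; apply: le_trans (ltW (le_lt_trans _ vx)) xi.
  by rewrite ler_peMl ?enorm_ge0.
(* Here subdifferential continuity enters: the heights converge too, so the epigraph points carrying
   the normals tend to [zbar]. *)
have cf := sc _ _ cx cv (fun i => let: And3 _ s _ := Hxv i in s).
have {}cf : (fine \o (fun i => f (xv i).1)) @ \oo --> fine (f xbar).
  by apply: fine_cvg; rewrite fineK.
pose k := K^-1.
have k0 : 0 < k by rewrite invr_gt0.
pose j := rshift n (ord0 : 'I_1).
pose Q y := epi f (zbar + y).
have dQ : definablev Q by apply: definablev_translate;
  exact: semialgebraic_definablev.
have hex eta : 0 < eta -> exists t y, 0 < t < eta /\ slope_small Q j k t y.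
  move=> eta0; have eta2 : 0 < eta / 2 by rewrite divr_gt0.
  have /cvg_l1normP/(_ _ eta2) cxe := cx.
  have /cvgrPdist_lt/(_ _ eta2) cfe := cf.
  have [i [xe fe]] := filter_ex (filterI cxe cfe).
  have [_ [fini Ni] vx] := Hxv i.
  pose z := row_mx (xv i).1 (fine (f (xv i).1))%:M : 'rV[R]_(n + 1).
  have zl : l1norm (z - zbar) =
      l1norm ((xv i).1 - xbar) + `|fine (f xbar) - fine (f (xv i).1)|.
    rewrite opp_row_mx add_row_mx l1norm_row_mx; congr (_ + _).
    by rewrite /l1norm big_ord1 !mxE eqxx !mulr1n distrC.
  apply: (limiting_normal_slope_small k0 (enorm_ge0 (xv i).2) Ni).
  - by rewrite row_mxEr mxE eqxx mulr1n.
  - by move=> l; rewrite row_mxEl; exact: coord_le_enorm.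
  - rewrite -/z zl mulrC ltr_pdivlMr // mulrC; apply: lt_le_trans vx _.
    by rewrite (le_trans (enorm_le_l1norm _)) // lerDl.
  - by rewrite -/z zl; move: xe fe => /=; lra.
have := slope_small_curve dQ (ltW k0) hex.
move=> /near0P[r r0 Hr].
(* [t <= eps] keeps the point in the ball of quadratic growth, and [t <= K / 2] makes [k * t ^+ 2]
   at most [t / 2], so that the horizontal part carries at least half of [t]. *)
have [t [t0 tr te tK]] : exists t, [/\ 0 < t, t < r, t <= eps & t <= K / 2].
  exists (Num.min (r / 2) (Num.min eps (K / 2))).
  by rewrite !lt_min !gt_min !ge_min !lexx !orbT !divr_gt0 //= eps0
    ltr_pdivrMr //; split=> //; lra.
have [y [Qy yt yk]] := Hr t t0 tr.
pose x := lsubmx (zbar + y); pose e := enorm (lsubmx y).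
have xE : x - xbar = lsubmx y
  by rewrite /x linearD /= row_mxKl addrAC subrr add0r.
have rE : rsubmx (zbar + y) 0 0 = fine (f xbar) + y 0 j.
  by rewrite linearD /= row_mxKr !mxE eqxx mulr1n.
have yE : t = l1norm (lsubmx y) + `|y 0 j|.
  rewrite -yt -[in LHS](hsubmxK y) l1norm_row_mx; congr (_ + _).
  by rewrite /l1norm big_ord1 mxE.
have xball : eball xbar eps x.
  rewrite /eball /= xE; apply: le_trans (enorm_le_l1norm _) _.
  by apply: le_trans te; rewrite yE lerDl.
have ej : alpha / 2 * e ^+ 2 <= y 0 j.
  have := le_trans (growth x xball) Qy.
  by rewrite xE -/e rE -(fineK fin0) -EFinD lee_fin lerD2l.
have j0 : 0 <= y 0 j by apply: le_trans ej;
  rewrite mulr_ge0 ?sqr_ge0 // ltW ?divr_gt0.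
have kt : K * (k * t ^+ 2) = t ^+ 2 by rewrite mulrA divff ?mul1r ?gt_eqF.
have ye : l1norm (lsubmx y) <= n%:R * e by exact: l1norm_le_enorm.
have t2e : t <= 2 * (n%:R * e).
  suff : y 0 j <= t / 2 by move: yE; rewrite ger0_norm //; lra.
  by apply: le_trans yk _; rewrite -(ler_pM2l K0) kt; nra.
have e0 : 0 < e.
  rewrite lt_def enorm_ge0 andbT; apply: contraTneq t0 => ee.
  by rewrite -leNgt (le_trans t2e) // ee !mulr0.
have Ka : K * alpha = 8 * n%:R ^+ 2 + alpha
  by rewrite mulrDl mul1r divfK ?gt_eqF.
have : K * (alpha / 2 * e ^+ 2) <= 4 * n%:R ^+ 2 * e ^+ 2.
  apply: le_trans (_ : t ^+ 2 <= _).
    by rewrite -kt ler_pM2l // (le_trans ej).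
  by rewrite (le_trans (_ : _ <= (2 * (n%:R * e)) ^+ 2)) ?ler_sqr ?nnegrE //;
    nra.
have : 0 < alpha * e ^+ 2 by rewrite mulr_gt0 // exprn_gt0.
have -> : K * (alpha / 2 * e ^+ 2) = K * alpha * e ^+ 2 / 2 by ring.
rewrite Ka; lra.
Qed.

End GrowthImpliesSubregularity.

(** * Subregularity implies quadratic growth *)

Section LowerSemicontinuity.
Variable R : realType.

(** The sets [B y] for [y] in [K] are nested and nonempty, so they generate a proper filter, which
    has a cluster point [p] in [K]. If [F y < F p], lower semicontinuity gives a neighbourhood of
    [p] that misses [B y]. *)
Lemma lsc_compact_min (T : ptopologicalType) (K : set T) (F : T -> \bar R) :
  compact K -> K !=set0 -> lower_semicontinuous F ->
  exists2 x, K x & forall y, K y -> (F x <= F y)%E.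
Proof.
move=> cK [x0 Kx0] lF.
pose B y := [set x | K x /\ (F x <= F y)%E].
have FB : Filter (filter_from K B).
  apply: filter_from_filter; first by exists x0.
  move=> i j Ki Kj; have [ij|/ltW ji] := leP (F i) (F j).
    by exists i => // x [Kx xi]; do !split=> //; exact: le_trans xi ij.
  by exists j => // x [Kx xj]; do !split=> //; exact: le_trans xj ji.
have PB : ProperFilter (filter_from K B).
  by apply: filter_from_proper => y Ky; exists y.
have [|p [Kp cp]] := cK _ PB; first by exists x0 => // x [].
exists p => // y Ky; rewrite leNgt; apply/negP => yp.
have [a ya ap] : exists2 a, (F y <= a%:E)%E & (a%:E < F p)%E.
  case: (F y) (F p) yp => [r| |] [s| |] //= yp.
  - by exists r.
  - by exists r.
  - by exists (s - 1); rewrite ?leNye // lte_fin gtrDl oppr_lt0.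
  - by exists 0; rewrite ?leNye // ltry.
have [V Vp Va] := lF p a ap.
have [x [[Kx xy] Vx]] := cp (B y) V (ex_intro2 _ _ y Ky (fun _ h => h)) Vp.
by have := lt_le_trans (Va x Vx) (le_trans xy ya); rewrite ltxx.
Qed.

Lemma lscD_continuous (T : topologicalType) (f : T -> \bar R) (g : T -> R) :
  lower_semicontinuous f -> continuous g ->
  lower_semicontinuous (fun x => f x + (g x)%:E)%E.
Proof.
move=> lf cg x a afg.
have [b ab bf] : exists2 b, a - g x < b & (b%:E < f x)%E.
  case: (f x) afg => [r| |] // afg; last by exists (a - g x + 1);
    rewrite ?ltrDl ?ltry.
  move: afg; rewrite -EFinD lte_fin => afg.
  by exists ((a - g x + r) / 2); rewrite ?lte_fin; lra.
have [V Vx Vb] := lf x b bf.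
have e0 : 0 < b - (a - g x) by rewrite subr_gt0.
have /cvgrPdist_lt/(_ _ e0) gx := cg x.
exists (V `&` [set y | `|g x - g y| < b - (a - g x)]); first exact: filterI.
move=> y [/Vb by_ /= gxy].
apply: (@le_lt_trans _ _ ((b + g y)%:E)).
  by rewrite lee_fin; move: gxy; rewrite ltr_norml => /andP[_]; lra.
by rewrite EFinD lteD2rE.
Qed.

Lemma continuous_sum (T : topologicalType) I (r : seq I) (F : I -> T -> R) :
  (forall i, continuous (F i)) -> continuous (fun x => \sum_(i <- r) F i x).
Proof.
move=> cF; elim: r => [|i r IH] x.
  by under eq_fun do rewrite big_nil; exact: cvg_cst.
by under eq_fun do rewrite big_cons; apply: cvgD; [exact: cF|exact: IH].
Qed.

Lemma continuous_sqr_enorm n (a : 'rV[R]_n) :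
  continuous (fun x : 'rV[R]_n => enorm (x - a) ^+ 2).
Proof.
have -> : (fun x : 'rV[R]_n => enorm (x - a) ^+ 2) =
    (fun x => \sum_i (x 0 i - a 0 i) * (x 0 i - a 0 i)).
  by apply/funext => x; rewrite sqr_enorm; apply: eq_bigr => i _; rewrite !mxE.
apply: continuous_sum => i x.
have ci : (fun y : 'rV[R]_n => y 0 i - a 0 i) @ x --> x 0 i - a 0 i.
  exact: (cvgB (@coord_continuous R 1 n 0 i x) (cvg_cst _)).
exact: (cvgM ci ci).
Qed.

Lemma compact_sqr_enorm_le n (a : 'rV[R]_n) s :
  compact [set x : 'rV[R]_n | enorm (x - a) ^+ 2 <= s].
Proof.
(* As [u ^+ 2 <= s] implies [u <= s + 1], a box of half-width [s + 1] contains the ball. *)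
apply: (@subclosed_compact _ _ [set x : 'rV[R]_n | forall i,
    `[a 0 i - (s + 1), a 0 i + (s + 1)]%classic (x ord0 i)]).
- have cl : closed ((fun x : 'rV[R]_n =>
  enorm (x - a) ^+ 2) @^-1` [set t | t <= s]).
    apply: closed_comp => [x _|]; last exact: closed_le.
    exact: continuous_sqr_enorm.
  exact: cl.
- apply: (@rV_compact R n (fun i => `[a 0 i - (s + 1),
  a 0 i + (s + 1)]%classic)).
  by move=> i; exact: segment_compact.
- move=> x /= xs i; rewrite /= in_itv /=.
  have xa : `|x 0 i - a 0 i| <= s + 1.
    have := coord_le_enorm (x - a) i; rewrite !mxE => /le_trans; apply.
    have := enorm_ge0 (x - a); nra.
  by move: xa; rewrite ler_norml => /andP[]; lra.
Qed.

End LowerSemicontinuity.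

Section SubregularityImpliesGrowth.
Variable R : realType.

Lemma edot_le_l1norm n (a b : 'rV[R]_n) : `|edot a b| <= enorm a * l1norm b.
Proof.
rewrite /edot /l1norm mulr_sumr; apply: le_trans (ler_norm_sum _ _ _) _.
by apply: ler_sum => i _; rewrite normrM ler_wpM2r // coord_le_enorm.
Qed.

Lemma sqr_enormD n (a b : 'rV[R]_n) :
  enorm (a + b) ^+ 2 = enorm a ^+ 2 + 2 * edot a b + enorm b ^+ 2.
Proof.
rewrite !sqr_enorm /edot mulr_sumr -!big_split /=.
by apply: eq_bigr => i _; rewrite !mxE; ring.
Qed.

Lemma edotZl n (c : R) (a b : 'rV[R]_n) : edot (c *: a) b = c * edot a b.
Proof. by rewrite /edot mulr_sumr; apply: eq_bigr => i _;
  rewrite mxE mulrA. Qed.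

Lemma enormZ n (c : R) (a : 'rV[R]_n) : enorm (c *: a) = `|c| * enorm a.
Proof.
rewrite /enorm edotZl.
have -> : edot a (c *: a) = c * edot a a.
  by rewrite /edot mulr_sumr; apply: eq_bigr => i _; rewrite mxE; ring.
by rewrite mulrA -expr2 sqrtrM ?sqr_ge0 // sqrtr_sqr.
Qed.

Lemma sqr_enorm_row_mx n (a : 'rV[R]_n) (b : R) :
  enorm (row_mx a b%:M : 'rV[R]_(n + 1)) ^+ 2 = enorm a ^+ 2 + b ^+ 2.
Proof.
rewrite !sqr_enorm /edot big_split_ord /= big_ord1 row_mxEr mxE eqxx mulr1n
  expr2.
by congr (_ + _); apply: eq_bigr => i _; rewrite row_mxEl.
Qed.

(** The quadratic minorant makes [(v, -1)] a Frechet normal to the epigraph at [(y, c)], so constant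
    sequences witness the limiting normal. *)
Lemma proximal_subdifferential n (f : 'rV[R]_n -> \bar R) y c v r C :
  f y = c%:E -> 0 < r -> 0 <= C ->
  (forall x, enorm (x - y) < r ->
    ((c + edot v (x - y) - C * enorm (x - y) ^+ 2)%:E <= f x)%E) ->
  subdifferential f y v.
Proof.
move=> fy r0 C0 prox; split; first by rewrite fy.
rewrite fy /=; set zbar := row_mx y c%:M; set w := row_mx v (-1)%:M.
have epiz : epi f zbar.
  by rewrite /epi /= row_mxKl row_mxKr mxE eqxx mulr1n fy.
exists (fun=> zbar), (fun=> w); split=> //;
  [exact: cvg_cst|exact: cvg_cst|move=> _].
(* The positive part of the inner product serves as the error term; on the epigraph near [zbar] the
   minorant bounds it by [C] times the squared distance. *)
exists (fun z => Num.max 0 (edot w (z - zbar))); split; last first.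
  by move=> z _; rewrite le_max lexx orbT.
have bound z : epi f z -> enorm (z - zbar) < r ->
    Num.max 0 (edot w (z - zbar)) <= C * enorm (z - zbar) ^+ 2.
  move=> Qz zr; rewrite ge_max mulr_ge0 ?sqr_ge0 //=.
  set x := lsubmx z; set s := rsubmx z 0 0.
  have zE : z - zbar = row_mx (x - y) (s - c)%:M.
    rewrite -[z in LHS](hsubmxK z) opp_row_mx add_row_mx; congr row_mx.
    by apply/rowP => i; rewrite /s !ord1 !mxE eqxx !mulr1n.
  have xz : enorm (x - y) ^+ 2 <= enorm (z - zbar) ^+ 2.
    by rewrite zE sqr_enorm_row_mx lerDl sqr_ge0.
  have xr : enorm (x - y) < r.
    by apply: le_lt_trans zr; rewrite -ler_sqr ?nnegrE ?enorm_ge0.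
  have := le_trans (prox x xr) Qz; rewrite lee_fin -/s => H.
  have -> : edot w (z - zbar) = edot v (x - y) - (s - c).
    rewrite zE edot_row_mx !row_mxEr !mxE eqxx !mulr1n mulN1r; congr (_ - _).
    by apply: eq_bigr => i _; rewrite !row_mxEl.
  apply: le_trans (ler_wpM2l C0 xz); lra.
apply/cvgrPdist_lt => e e0.
have d0 : 0 < Num.min r (e / (C + 1)).
  by rewrite lt_min r0 divr_gt0 // ltr_wpDl //.
apply/nbhs_l1normP; exists (Num.min r (e / (C + 1))) => // z.
move=> /(le_lt_trans (enorm_le_l1norm _)); rewrite lt_min => /andP[zr ze] _ Qz.
rewrite sub0r normrN; set N := enorm (z - zbar) in zr ze *.
have [->|N0] := eqVneq N 0; first by rewrite invr0 mulr0 normr0.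
have {}N0 : 0 < N by rewrite lt_def N0 enorm_ge0.
rewrite ger0_norm; last by rewrite divr_ge0 ?le_max ?lexx // ltW.
rewrite ltr_pdivrMr //; apply: le_lt_trans (bound z Qz zr) _.
rewrite -/N expr2 mulrA ltr_pM2r //.
move: ze; rewrite ltr_pdivlMr ?ltr_wpDl //; lra.
Qed.

End SubregularityImpliesGrowth.

(** * Penalised minimisation and the growth inequality *)

Section GrowthOfSubregular.
Variable R : realType.

(** Concavity of the square root: the gap to the tangent at [s ^+ 2] is
    [(Num.sqrt a - s) ^+ 2 / (2 * s)]. *)
Lemma sqrtr_le_tangent (s a : R) : 0 < s -> 0 <= a ->
  Num.sqrt a <= s + (a - s ^+ 2) / (2 * s).
Proof.
move=> s0 a0; rewrite -{2}(sqr_sqrtr a0) -subr_ge0.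
have -> : s + (Num.sqrt a ^+ 2 - s ^+ 2) / (2 * s) - Num.sqrt a =
    (Num.sqrt a - s) ^+ 2 / (2 * s) by field; rewrite gt_eqF.
by rewrite divr_ge0 ?sqr_ge0 // mulr_ge0 // ltW.
Qed.

(* [| |x - xbar|^2 - |x0 - xbar|^2 |] takes the same value [|x0 - xbar|^2] at
   [xbar] and on the boundary of the ball [|x - xbar|^2 <= 2 |x0 - xbar|^2], so
   the minimum of the penalised function is attained elsewhere. *)
Lemma small_subgradient n (f : 'rV[R]_n -> \bar R) (xbar x0 : 'rV[R]_n) alpha :
  lower_semicontinuous f -> f xbar \is a fin_num -> 0 < alpha ->
  (forall x, enorm (x - xbar) ^+ 2 <= 2 * enorm (x0 - xbar) ^+ 2 ->
    (f xbar <= f x)%E) ->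
  (f x0 < f xbar + (alpha / 2 * enorm (x0 - xbar) ^+ 2)%:E)%E ->
  exists y v, [/\ subdifferential f y v, 0 < enorm (y - xbar),
    enorm (y - xbar) ^+ 2 <= 2 * enorm (x0 - xbar) ^+ 2 &
    enorm v <= alpha * enorm (y - xbar)].
Proof.
move=> lf finx alpha0 fmin fx0.
pose q (x : 'rV[R]_n) := enorm (x - xbar) ^+ 2; pose t0 := q x0.
pose b0 := fine (f xbar); have fxbar : f xbar = b0%:E by rewrite fineK.
have t00 : 0 <= t0 by exact: sqr_ge0.
pose beta := alpha / 2; have beta0 : 0 < beta by rewrite divr_gt0.
have [a0 fx0E] : exists a0, f x0 = a0%:E.
  have : (f xbar <= f x0)%E by apply: fmin; rewrite -/(q x0) -/t0; lra.
  move: fx0; rewrite fxbar; case: (f x0) => [r| |] // _ _; by exists r.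
have gap : 0 < b0 + beta * t0 - a0.
  by move: fx0; rewrite fx0E fxbar -EFinD lte_fin subr_gt0.
(* Smoothing raises the penalty at [x0] from [0] to [beta * delta], half of the gap, so the
   penalised value there stays below [b0 + beta * t0]. *)
pose delta := (b0 + beta * t0 - a0) / (2 * beta).
have delta0 : 0 < delta by rewrite divr_gt0 // mulr_gt0.
have betad : beta * delta < b0 + beta * t0 - a0.
  have -> : beta * delta = (b0 + beta * t0 - a0) / 2.
    by rewrite /delta; field; rewrite gt_eqF.
  by rewrite gtr_pMr // invf_lt1 ?ltr1n.
pose S x := Num.sqrt ((q x - t0) ^+ 2 + delta ^+ 2).
have cS : continuous (fun x => beta * S x).
  have cq : continuous q by exact: continuous_sqr_enorm.
  move=> x.
  have cw : (fun y => q y - t0) @ x --> q x - t0.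
    exact: (cvgB (cq x) (cvg_cst t0)).
  have cw2 : (fun y => (q y - t0) ^+ 2) @ x --> (q x - t0) ^+ 2.
    have -> : (fun y => (q y - t0) ^+ 2) = (fun y => (q y - t0) * (q y - t0)).
      by apply/funext => y; rewrite expr2.
    by rewrite expr2; exact: (cvgM cw cw).
  have cs : S @ x --> S x.
    exact: (cvg_comp _ _ (cvgD cw2 (cvg_cst (delta ^+ 2))) (@sqrt_continuous R
      _)).
  exact: (cvgM (cvg_cst beta) cs).
have [|y Ky ymin] := lsc_compact_min (@compact_sqr_enorm_le _ _ xbar (2 * t0)) _
    (lscD_continuous lf cS).
  by exists x0 => /=; rewrite -/(q x0) -/t0; lra.
have Sx0 : S x0 = delta.
  by rewrite /S -/t0 subrr expr0n add0r sqrtr_sqr gtr0_norm.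
have fy_ge : (b0%:E <= f y)%E by rewrite -fxbar; exact: fmin.
have fy_lt : (f y + (beta * S y)%:E < (b0 + beta * t0)%:E)%E.
  apply: le_lt_trans (ymin x0 _) _; first by rewrite /= -/(q x0) -/t0; lra.
  by rewrite fx0E Sx0 -EFinD lte_fin; lra.
have [c fyE] : exists c, f y = c%:E.
  by move: fy_ge fy_lt; case: (f y) => [r| |] // _ _; exists r.
have b0c : b0 <= c by move: fy_ge; rewrite fyE lee_fin.
pose w := q y - t0; pose s := S y.
have s0 : 0 < s.
  by rewrite sqrtr_gt0 ltr_wpDl ?sqr_ge0 // exprn_gt0.
have s2 : s ^+ 2 = w ^+ 2 + delta ^+ 2.
  by rewrite sqr_sqrtr // addr_ge0 ?sqr_ge0.
have ws : `|w| <= s.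
  by rewrite -sqrtr_sqr ler_wsqrtr // lerDl sqr_ge0.
(* Since [f xbar <= f y], the penalty at [y] is less than [beta * t0]. Hence [|q y - t0| < t0],
   which puts [y] in the interior of the ball and away from [xbar]. *)
have st0 : s < t0.
  move: fy_lt; rewrite fyE -EFinD lte_fin -/s => H.
  by rewrite -(ltr_pM2l beta0); lra.
have [q0 q2] : 0 < q y /\ q y < 2 * t0.
  by move: (le_lt_trans ws st0); rewrite ltr_norml /w => /andP[]; split; lra.
have Y0 : 0 < enorm (y - xbar).
  by move: q0; rewrite /q exprn_even_gt0 //= lt_def enorm_ge0 andbT.
(* Minus the gradient of [beta * S] at [y]; its norm is controlled through [|w / s| <= 1]. *)
pose v := (- (2 * beta * w / s)) *: (y - xbar).
exists y, v; split=> //; last first.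
  rewrite enormZ normrN ler_wpM2r ?enorm_ge0 //.
  have -> : 2 * beta * w / s = alpha * (w / s) by rewrite /beta; field;
    rewrite gt_eqF.
  rewrite normrM (gtr0_norm alpha0) ger_pMr // normrM normfV (gtr0_norm s0).
  by rewrite ler_pdivrMr // mul1r.
have [r r0 Hr] : exists2 r, 0 < r & forall x, enorm (x - y) < r ->
    q x <= 2 * t0 /\ enorm (x - y) <= 1.
  have [e e0 He] := (nbhs_l1normP y [set x | q x <= 2 * t0]).1
    (cvgr_le _ (@continuous_sqr_enorm _ _ xbar y) _ q2).
  exists (Num.min 1 (e / n.+1%:R)); first by rewrite lt_min ltr01 divr_gt0.
  move=> x; rewrite lt_min => /andP[x1 xe]; split; last exact: ltW.
  apply: He; apply: le_lt_trans (l1norm_le_enorm _) _.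
  move: xe; rewrite ltr_pdivlMr // mulrC; apply: le_lt_trans.
  by rewrite ler_wpM2r ?enorm_ge0 // ler_nat.
(* [M * enorm (x - y)] bounds [|q x - q y|] when [enorm (x - y) <= 1]. Below, [C] adds the quadratic
   term of [q] to the second-order term of the tangent bound for the root. *)
pose M := 2 * enorm (y - xbar) * n%:R + 1.
have M0 : 0 <= M by rewrite addr_ge0 ?mulr_ge0 ?enorm_ge0.
pose C := beta + beta * M ^+ 2 / (2 * s).
apply: (@proximal_subdifferential _ _ _ _ c _ r C) => //.
  apply: addr_ge0; first exact: ltW.
  apply: divr_ge0; last by rewrite mulr_ge0 // ltW.
  by apply: mulr_ge0; [exact: ltW|exact: sqr_ge0].
move=> x xr; have [qx xy1] := Hr x xr.
have := ymin x qx; have := fmin x qx; rewrite fyE fxbar.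
case: (f x) => [rx| |] //= _; last by move=> _; rewrite leey.
rewrite -!EFinD !lee_fin -/s => H.
set D := edot (y - xbar) (x - y); set e := enorm (x - y) in xy1 *.
have e0 : 0 <= e by exact: enorm_ge0.
pose p := 2 * D + e ^+ 2.
have qxE : q x - t0 = w + p.
  rewrite /q (_ : x - xbar = (y - xbar) + (x - y)).
    by rewrite sqr_enormD -/D -/e /w /p /q; ring.
  by apply/rowP => i; rewrite !mxE; ring.
have DE : `|D| <= enorm (y - xbar) * n%:R * e.
  apply: le_trans (edot_le_l1norm _ _) _; rewrite -mulrA.
  by rewrite ler_wpM2l ?enorm_ge0 // l1norm_le_enorm.
have pM : `|p| <= M * e.
  apply: le_trans (ler_normD _ _) _.
  rewrite normrM (ger0_norm (ler0n _ 2)) (ger0_norm (sqr_ge0 e)).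
  have ee : e ^+ 2 <= e by rewrite expr2 ler_piMl.
  by rewrite /M; lra.
have p2 : p ^+ 2 <= M ^+ 2 * e ^+ 2.
  by rewrite -exprMn -[p ^+ 2]real_normK ?num_real // ler_sqr ?nnegrE ?mulr_ge0.
have Sx : S x <= s + (2 * w * p + p ^+ 2) / (2 * s).
  apply: le_trans (sqrtr_le_tangent s0 _) _; first by rewrite addr_ge0 ?sqr_ge0.
  by rewrite qxE s2 lerD2l (_ : _ + _ - _ = 2 * w * p + p ^+ 2) //; ring.
have {}H : c <= rx + beta * ((2 * w * p + p ^+ 2) / (2 * s)).
  by have := ler_wpM2l (ltW beta0) Sx; lra.
have wse : w / s * e ^+ 2 <= e ^+ 2.
  rewrite ler_piMl ?sqr_ge0 // ler_pdivrMr // mul1r.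
  exact: le_trans (ler_norm _) ws.
have pse : p ^+ 2 / (2 * s) <= M ^+ 2 * e ^+ 2 / (2 * s).
  by rewrite ler_pM2r // invr_gt0 mulr_gt0.
rewrite edotZl -/D.
have -> : - (2 * beta * w / s) * D = - beta * (w / s * (2 * D)) by ring.
have E1 : (2 * w * p + p ^+ 2) / (2 * s) =
    w / s * (2 * D) + w / s * e ^+ 2 + p ^+ 2 / (2 * s).
  by rewrite /p; field; rewrite gt_eqF.
have E2 : C * e ^+ 2 = beta * (e ^+ 2 + M ^+ 2 * e ^+ 2 / (2 * s)).
  by rewrite /C; ring.
rewrite E2; rewrite E1 in H.
have := ler_wpM2l (ltW beta0) (lerD wse pse); lra.
Qed.

End GrowthOfSubregular.

Lemma edistance0_le (R : realType) n (S : set 'rV[R]_n) v :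
  S v -> (edistance 0 S <= (enorm v)%:E)%E.
Proof. by move=> Sv; apply: ereal_inf_lbound; exists v;
  rewrite ?enorm_subr0. Qed.

Lemma growth_of_subregular (R : realType) n (f : 'rV[R]_n ->
  \bar R) xbar kappa alpha :
  lower_semicontinuous f -> local_minimizer f xbar ->
  strongly_subregular (subdifferential f) xbar 0 kappa ->
  0 < alpha -> kappa * alpha < 1 -> quadratic_growth f xbar alpha.
Proof.
move=> lf /nbhs_l1normP[r r0 fmin] [[finx _] k0 [d d0 sub]] alpha0 ka.
(* Points with squared distance to [xbar] at most twice that of [x0] stay within [2 * eps], which
   has to fit in the ball of subregularity and, after passing to the l1-norm, in the neighbourhood
   of minimality. *)
pose eps := Num.min (r / n.+1%:R) d / 2.
have m0 : 0 < Num.min (r / n.+1%:R) d by rewrite lt_min d0 divr_gt0.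
have eps0 : 0 < eps by rewrite divr_gt0.
have eps2r : n%:R * (2 * eps) < r.
  have : 2 * eps <= r / n.+1%:R
    by rewrite /eps mulrC divfK ?gt_eqF // ge_min lexx.
  rewrite ler_pdivlMr // -natr1; move: r0 eps0; nra.
have eps2d : 2 * eps <= d
  by rewrite /eps mulrC divfK ?gt_eqF // ge_min lexx orbT.
exists eps => // x0 x0eps; rewrite leNgt; apply/negP => fx0.
have close x : enorm (x - xbar) ^+ 2 <= 2 * enorm (x0 - xbar) ^+ 2 ->
    enorm (x - xbar) <= 2 * eps.
  move=> xx0; have e0 := enorm_ge0 (x0 - xbar).
  have eps2 : 0 <= 2 * eps by rewrite mulr_ge0 // ltW.
  rewrite -ler_sqr ?nnegrE ?enorm_ge0 ?eps2 //.
  by move: x0eps; rewrite /eball /= => x0eps; nra.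
have fminK x : enorm (x - xbar) ^+ 2 <= 2 * enorm (x0 - xbar) ^+ 2 ->
    (f xbar <= f x)%E.
  move=> xx0; apply: fmin; apply: le_lt_trans (l1norm_le_enorm _) _.
  by apply: le_lt_trans eps2r; rewrite ler_wpM2l ?close.
have [y [v [dv y0 yx0 vy]]] := small_subgradient lf finx alpha0 fminK fx0.
have yd : eball xbar d y by exact: le_trans (close y yx0) eps2d.
have := sub y yd (ex_intro _ v dv).
have k0' : (0 <= kappa%:E)%E by rewrite lee_fin.
move=> /le_trans/(_ (lee_wpmul2l k0' (edistance0_le dv))).
rewrite -EFinM lee_fin => yv.
have : kappa * enorm v <= kappa * alpha * enorm (y - xbar).
  by rewrite -mulrA ler_wpM2l.
by move: y0 ka; nra.
Qed.

(* In the first part, the library's extended inverse satisfies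
   (0%:E)^-1 = +oo. *)
Theorem theorem3p1 (R : realType) (n : nat) (f : 'rV[R]_n -> \bar R)
  (xbar : 'rV[R]_n)
  (hlsc : lower_semicontinuous f)
  (hsa : semialgebraic f)
  (hmin : local_minimizer f xbar) :
  (forall kappa : R, strongly_subregular (subdifferential f) xbar 0 kappa ->
    (exists2 alpha : R, 0 < alpha & quadratic_growth f xbar alpha) /\
    (forall alpha : R, 0 < alpha -> (alpha%:E < (kappa%:E)^-1)%E ->
      quadratic_growth f xbar alpha)) /\
  (subdifferentially_continuous f xbar 0 ->
    (exists2 alpha : R, 0 < alpha & quadratic_growth f xbar alpha) ->
    exists kappa : R, strongly_subregular (subdifferential f) xbar 0 kappa).
Proof.
split=> [kappa sub|hsc [alpha alpha0 growth]]; last first.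
  exact: subregular_of_growth hsa hsc alpha0 growth.
have k0 : 0 <= kappa by case: sub.
split=> [|alpha alpha0 ak]; last first.
  apply: growth_of_subregular hlsc hmin sub alpha0 _.
  have [->|kn0] := eqVneq kappa 0; first by rewrite mul0r.
  have kp : 0 < kappa by rewrite lt_def kn0.
  by move: ak; rewrite inver (negPf kn0) lte_fin -ltr_pdivlMl // mulr1.
(* Adding [1] also covers [kappa = 0]. *)
exists (kappa + 1)^-1; first by rewrite invr_gt0 ltr_wpDl.
apply: growth_of_subregular hlsc hmin sub _ _;
  first by rewrite invr_gt0 ltr_wpDl.
by rewrite ltr_pdivrMr ?ltr_wpDl // mul1r ltrDl.
Qed.
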